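(* Let $r_1,r_2,r_3>0$, $\mathbf{r}=(r_1,r_2,r_3)$, and let $\{\varphi_{(\mathbf{r},h)}: h\in\mathrm{Sp}(1)\}$ be the associated family of isometric $\mathrm{Ad}(\mathrm{Sp}(1))$-invariant $\mathrm{G}_2$-structures on $\mathbb{S}^7=\mathrm{Sp}(2)/\mathrm{Sp}(1)$, parametrised by $[h]\in\mathbb{RP}^3$. According to the values of $(r_1,r_2,r_3)$, and up to cyclic permutation of the parameters, the structures parametrised by the following sets are exactly the critical points of the energy functional $E$ in the family, i.e. its harmonic $\mathrm{G}_2$-structures (the critical set is the union of the sets listed in those cases below, together with their cyclic permutations, whose condition is satisfied): (i) If $r_1=r_2=r_3=r^{1/3}$: for $r=1$ all of $\mathbb{RP}^3$; for $r\neq1$ the sets $\{[(h_0,h_1,0,h_3)]\}$ and $[(0,0,\pm1,0)]$. (ii) If $\rho_0=0$: $\{(r_1,r_2,r_3)\}\times\mathbb{S}^1_{0,2}$. (iii) If $\rho_1=\rho_3\neq0$: $\{(r_1,r_2,r_3)\}\times\mathbb{S}^1_{1,3}$. (iv) If $\rho_1=\rho_3=0$: $\{(r_1,r_2,r_3)\}\times\mathbb{S}^2_{1,2,3}$. (v) If $\rho_0=\rho_1=\rho_3\neq0$: $\{(r_1,r_2,r_3)\}\times\mathbb{S}^2_{0,1,3}$. (vi) If $\rho_0=\rho_1=\rho_3=0$: $|T|^2$ is constant on the isometric class and so the critical points are $\{(r_1,r_2,r_3)\}\times\mathbb{RP}^3$. (vii) For any $(r_1,r_2,r_3)$: the poles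 $\{(r_1,r_2,r_3)\}\times\mathrm{NS}_k$, $k=0,1,2,3$, are critical points.
   Context: $\mathrm{Sp}(1)\subset\mathrm{Sp}(2)$ via $h\mapsto\mathrm{diag}(h,1)$; $\mathbb{S}^7=\mathrm{Sp}(2)/\mathrm{Sp}(1)$; $\mathfrak{p}=\mathfrak{sp}(1)^\perp\simeq T_o\mathbb{S}^7$ has basis $e_1=\mathrm{diag}(0,i)$, $e_2=\mathrm{diag}(0,j)$, $e_3=\mathrm{diag}(0,k)$, $e_4=\frac1{\sqrt2}\begin{pmatrix}0&i\\ i&0\end{pmatrix}$, $e_5=\frac1{\sqrt2}\begin{pmatrix}0&j\\ j&0\end{pmatrix}$, $e_6=\frac1{\sqrt2}\begin{pmatrix}0&k\\ k&0\end{pmatrix}$, $e_7=\frac1{\sqrt2}\begin{pmatrix}0&1\\-1&0\end{pmatrix}$, dual basis $e^i$; $\omega_1=e^{47}+e^{56}$, $\omega_2=e^{46}-e^{57}$, $\omega_3=e^{45}+e^{67}$. Invariant tensors on $\mathbb{S}^7$ are identified with $\mathrm{Ad}(\mathrm{Sp}(1))$-invariant tensors on $\mathfrak{p}$, and for invariant $1$-forms $d\alpha(X,Y)=-\alpha([X,Y]_{\mathfrak p})$. For a unit quaternion $h=(h_0,h_1,h_2,h_3)$, $$\varphi_{(\mathbf{r},h)}=(r_1r_2r_3)^3e^{123}+\sum_{i=1}^3\Big(\tfrac{r_1^2}{r_2r_3}\Upsilon(h)_{i1}e^1+\tfrac{r_2^2}{r_1r_3}\Upsilon(h)_{i2}e^2+\tfrac{r_3^2}{r_1r_2}\Upsilon(h)_{i3}e^3\Big)\wedge\omega_i,$$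 $$\Upsilon(h)=\begin{pmatrix}h_0^2+h_1^2-h_2^2-h_3^2&2(h_1h_2-h_0h_3)&2(h_1h_3+h_0h_2)\\2(h_1h_2+h_0h_3)&h_0^2-h_1^2+h_2^2-h_3^2&2(h_2h_3-h_0h_1)\\2(h_1h_3-h_0h_2)&2(h_2h_3+h_0h_1)&h_0^2-h_1^2-h_2^2+h_3^2\end{pmatrix}.$$ It depends only on $[h]=\{\pm h\}\in\mathbb{RP}^3$ and induces the metric $r_1^6(e^1)^2+r_2^6(e^2)^2+r_3^6(e^3)^2+\frac{1}{r_1r_2r_3}\sum_{i=4}^7(e^i)^2$. Set $\rho_0=f(r_1,r_2,r_3)$, $\rho_1=f(r_2,r_3,r_1)$, $\rho_3=f(r_3,r_1,r_2)$, where $$f(x,y,z)=4\frac{x+z}{x^6y^3z^6}(x^2-xz+z^2)(x^4yz^4+2)(x^6+y^6+z^6-2x^3z^3-x^4y^7z^4).$$ A cyclic permutation of the parameters sends $\rho_0\to\rho_1\to\rho_3\to\rho_0$ and correspondingly $h_0\to h_1\to h_3\to h_0$, fixing $h_2$. Subsets of $\mathbb{RP}^3$: $\mathbb{S}^2_{k,l,m}=\{[h]: h_k^2+h_l^2+h_m^2=1\}$, $\mathbb{S}^1_{k,l}=\{[h]: h_k^2+h_l^2=1\}$, $\mathrm{NS}_k=\{[h]: h_k=\pm1\}$. The full torsion tensor $T$ of $\varphi$, with $\psi=*\varphi$, is given by $\nabla_i\varphi_{jkl}=T_i{}^m\psi_{mjkl}$; $(\mathrm{div}\,T)_j=\nabla^iT_{ij}$;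 $E(\varphi)=\frac12\int|T_\varphi|^2\mathrm{vol}_\varphi$. $\varphi$ is harmonic if $\mathrm{div}\,T=0$, i.e. it is critical for $E$ among $\mathrm{G}_2$-structures inducing the same metric and orientation. *)

(* Defs.v *)
From HB Require Import structures.
From mathcomp Require Import all_boot all_order all_algebra.
From mathcomp Require Import all_classical all_reals all_analysis.
From mathcomp Require Import ring.

Set Implicit Arguments.
Unset Strict Implicit.
Unset Printing Implicit Defensive.

Import Order.TTheory GRing.Theory Num.Theory.
Import numFieldNormedType.Exports.

Local Open Scope classical_set_scope.
Local Open Scope ring_scope.

(** * Quaternions, [sp(2)] and the reductive complement [p] *)

(* The quaternion h0 + h1 i + h2 j + h3 k is the row vector (h0, h1, h2, h3);
   its components are [h 0 0], [h 0 1], [h 0 2], [h 0 3]. *)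
Definition quat (R : realType) : Type := 'rV[R]_4.

HB.instance Definition _ (R : realType) := GRing.Zmodule.on (quat R).

Section Quaternion.
Variable R : realType.
Implicit Types x y : quat R.

Definition mkquat (a b c d : R) : quat R := \row_(k < 4) [:: a; b; c; d]`_k.

Definition qmul x y : quat R := mkquat
  (x 0 0 * y 0 0 - x 0 1 * y 0 1 - x 0 2 * y 0 2 - x 0 3 * y 0 3)
  (x 0 0 * y 0 1 + x 0 1 * y 0 0 + x 0 2 * y 0 3 - x 0 3 * y 0 2)
  (x 0 0 * y 0 2 - x 0 1 * y 0 3 + x 0 2 * y 0 0 + x 0 3 * y 0 1)
  (x 0 0 * y 0 3 + x 0 1 * y 0 2 - x 0 2 * y 0 1 + x 0 3 * y 0 0).

Lemma quatP x y : x 0 0 = y 0 0 -> x 0 1 = y 0 1 -> x 0 2 = y 0 2 ->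
  x 0 3 = y 0 3 -> x = y.
Proof.
move=> e0 e1 e2 e3; apply/rowP => -[[|[|[|[|//]]]] lt_k4].
- by rewrite (_ : Ordinal _ = 0) //; apply: val_inj.
- by rewrite (_ : Ordinal _ = 1) //; apply: val_inj.
- by rewrite (_ : Ordinal _ = 2) //; apply: val_inj.
- by rewrite (_ : Ordinal _ = 3) //; apply: val_inj.
Qed.

Lemma qmulA : associative qmul.
Proof. by move=> x y z; apply: quatP; rewrite !mxE /=; ring. Qed.

Lemma qmul1q : left_id (mkquat 1 0 0 0) qmul.
Proof. by move=> x; apply: quatP; rewrite !mxE /=; ring. Qed.

Lemma qmulq1 : right_id (mkquat 1 0 0 0) qmul.
Proof. by move=> x; apply: quatP; rewrite !mxE /=; ring. Qed.

Lemma qmulDl : left_distributive qmul +%R.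
Proof. by move=> x y z; apply: quatP; rewrite !mxE /=; ring. Qed.

Lemma qmulDr : right_distributive qmul +%R.
Proof. by move=> x y z; apply: quatP; rewrite !mxE /=; ring. Qed.

Lemma quat1_neq0 : mkquat 1 0 0 0 != 0 :> quat R.
Proof. by apply/eqP => /rowP/(_ 0); rewrite !mxE /= => /eqP; rewrite oner_eq0. Qed.

HB.instance Definition _ := GRing.Zmodule_isNzRing.Build (quat R)
  qmulA qmul1q qmulq1 qmulDl qmulDr quat1_neq0.

Definition qi : quat R := mkquat 0 1 0 0.
Definition qj : quat R := mkquat 0 0 1 0.
Definition qk : quat R := mkquat 0 0 0 1.

Definition mx2 (a b c d : quat R) : 'M[quat R]_2 :=
  \matrix_(i, j) if i == 0 then (if j == 0 then a else b)
                 else (if j == 0 then c else d).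

Definition qscale (s : R) (x : quat R) : quat R :=
  mkquat (s * x 0 0) (s * x 0 1) (s * x 0 2) (s * x 0 3).

(* e_(i+1) is [basis_p i]. *)
Definition basis_p (i : 'I_7) : 'M[quat R]_2 :=
  let s := qscale (Num.sqrt 2)^-1 in
  nth 0 [:: mx2 0 0 0 qi; mx2 0 0 0 qj; mx2 0 0 0 qk;
            mx2 0 (s qi) (s qi) 0; mx2 0 (s qj) (s qj) 0;
            mx2 0 (s qk) (s qk) 0; mx2 0 (s 1) (- s 1) 0] i.

Definition lie_bracket (A B : 'M[quat R]_2) : 'M[quat R]_2 := A *m B - B *m A.

(* Re tr(A^* B), the Ad-invariant inner product of sp(2) for which
   p = sp(1)^perp; the basis e_1, ..., e_7 is orthonormal for it. *)
Definition sp2_dot (A B : 'M[quat R]_2) : R :=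
  \sum_(a < 2) \sum_(b < 2) \sum_(k < 4) A a b 0 k * B a b 0 k.

(* e^k([e_i, e_j]_p): pairing with the orthonormal vector e_k is the dual
   1-form e^k extended by zero on sp(1). *)
Definition bracket_p (i j k : 'I_7) : R :=
  sp2_dot (basis_p k) (lie_bracket (basis_p i) (basis_p j)).

(** * Invariant tensors

   An invariant tensor on S^7 = Sp(2)/Sp(1) is given by its components on the
   basis of p.  Bilinear tensors are matrices, and a metric [g] is the Gram
   matrix g(e_i, e_j). *)

Definition tensor3 := 'I_7 -> 'I_7 -> 'I_7 -> R.
Definition tensor4 := 'I_7 -> 'I_7 -> 'I_7 -> 'I_7 -> R.

(* [nabla g i j k] is the e_k-component of nabla_(e_i) e_j for the Levi-Civita
   connection (Nomizu map) of the invariant metric g, from Koszul's formula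
   2 g(nabla_X Y, Z) = g([X,Y]_p, Z) - g([Y,Z]_p, X) + g([Z,X]_p, Y).
   It is torsion free for nabla_X Y - nabla_Y X = [X,Y]_p, in accordance with
   d alpha(X, Y) = - alpha([X,Y]_p). *)
Definition nabla (g : 'M[R]_7) (i j k : 'I_7) : R :=
  \sum_(l < 7) 2^-1 *
    (\sum_(m < 7) (bracket_p i j m * g m l - bracket_p j l m * g m i
                   + bracket_p l i m * g m j)) * invmx g l k.

(* Covariant derivatives of invariant tensors: (nabla_X S)(Y, ...) =
   - S(nabla_X Y, ...) - ..., since S(Y, ...) is constant. *)
Definition nabla_form (g : 'M[R]_7) (phi : tensor3) : tensor4 := fun i j k l =>
  - \sum_(m < 7) (nabla g i j m * phi m k l + nabla g i k m * phi j m l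
                  + nabla g i l m * phi j k m).

Definition nabla_bilin (g T : 'M[R]_7) : tensor3 := fun k i j =>
  - \sum_(m < 7) (nabla g k i m * T m j + nabla g k j m * T i m).

(* Levi-Civita symbol: the product of the signs of s_b - s_a over a < b. *)
Definition levi_civita (s : seq 'I_7) : R :=
  (\prod_(b < size s) \prod_(a < b)
     Num.sg ((nth 0 s b : nat)%:Z - (nth 0 s a : nat)%:Z))%:~R.

(* Hodge star of a 3-form for the metric g and the orientation e^1...e^7, which
   is the one induced by the G2-structures [phi] below. *)
Definition hodge3 (g : 'M[R]_7) (phi : tensor3) : tensor4 := fun j k l m =>
  Num.sqrt (\det g) / 6 *
  \sum_(a < 7) \sum_(b < 7) \sum_(c < 7)
    (\sum_(a' < 7) \sum_(b' < 7) \sum_(c' < 7)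
       invmx g a a' * invmx g b b' * invmx g c c' * phi a' b' c')
    * levi_civita [:: a; b; c; j; k; l; m].

(** * Torsion, divergence and energy of a G2-structure [phi] with metric [g] *)

(* nabla_i phi_jkl = T_i^m psi_mjkl with psi = *phi *)
Definition is_full_torsion (g : 'M[R]_7) (phi : tensor3) (T : 'M[R]_7) : Prop :=
  forall i j k l : 'I_7,
    nabla_form g phi i j k l =
    \sum_(m < 7) (\sum_(n < 7) T i n * invmx g n m) * hodge3 g phi m j k l.

(* This equation has exactly one solution when phi is a G2-structure inducing
   the metric g and the orientation e^1...e^7. *)
Definition full_torsion (g : 'M[R]_7) (phi : tensor3) : 'M[R]_7 :=
  xget 0 [set T | is_full_torsion g phi T].

(* (div T)_j = nabla^i T_ij *)
Definition divergence (g T : 'M[R]_7) (j : 'I_7) : R :=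
  \sum_(i < 7) \sum_(k < 7) invmx g i k * nabla_bilin g T k i j.

Definition normsq (g T : 'M[R]_7) : R :=
  \sum_(i < 7) \sum_(j < 7) \sum_(k < 7) \sum_(l < 7)
    invmx g i k * invmx g j l * T i j * T k l.

Definition harmonic_G2 (g : 'M[R]_7) (phi : tensor3) : Prop :=
  forall j, divergence g (full_torsion g phi) j = 0.

(* The integral of e^1...e^7 over S^7: the round volume form is e^1...e^7 / 4,
   because e_4, ..., e_7 are tangent vectors of round length 1 / sqrt 2 (and
   e_1, e_2, e_3 of length 1), and the round S^7 has volume pi^4 / 3. *)
Definition coframe_volume : R := 4 * (pi ^+ 4 / 3).

(* |T|^2 is constant on S^7, being invariant, and vol = sqrt(det g) e^1...e^7. *)
Definition energy (g : 'M[R]_7) (phi : tensor3) : R :=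
  2^-1 * normsq g (full_torsion g phi) * (Num.sqrt (\det g) * coframe_volume).

(** * The isometric family [phi_(r,h)] *)

(* The dual 1-form e^k, k = 1, ..., 7 *)
Definition e_ (k : nat) (i : 'I_7) : R := (i.+1 == k)%:R.

Definition wedge11 (a b : 'I_7 -> R) : 'I_7 -> 'I_7 -> R :=
  fun i j => a i * b j - a j * b i.

Definition wedge12 (a : 'I_7 -> R) (w : 'I_7 -> 'I_7 -> R) : tensor3 :=
  fun i j k => a i * w j k + a j * w k i + a k * w i j.

Definition e2_ (k l : nat) : 'I_7 -> 'I_7 -> R := wedge11 (e_ k) (e_ l).

Definition omega1 i j : R := e2_ 4 7 i j + e2_ 5 6 i j.
Definition omega2 i j : R := e2_ 4 6 i j - e2_ 5 7 i j.
Definition omega3 i j : R := e2_ 4 5 i j + e2_ 6 7 i j.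

(* [omega i] is omega_(i+1). *)
Definition omega (i : 'I_3) : 'I_7 -> 'I_7 -> R :=
  nth omega1 [:: omega1; omega2; omega3] i.

Definition Upsilon (h : quat R) : 'M[R]_3 :=
  let h0 := h 0 0 in let h1 := h 0 1 in let h2 := h 0 2 in let h3 := h 0 3 in
  \matrix_(i, j) nth 0 (nth [::]
    [:: [:: h0 ^+ 2 + h1 ^+ 2 - h2 ^+ 2 - h3 ^+ 2;
            2 * (h1 * h2 - h0 * h3);
            2 * (h1 * h3 + h0 * h2)];
        [:: 2 * (h1 * h2 + h0 * h3);
            h0 ^+ 2 - h1 ^+ 2 + h2 ^+ 2 - h3 ^+ 2;
            2 * (h2 * h3 - h0 * h1)];
        [:: 2 * (h1 * h3 - h0 * h2);
            2 * (h2 * h3 + h0 * h1);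
            h0 ^+ 2 - h1 ^+ 2 - h2 ^+ 2 + h3 ^+ 2]] i) j.

Definition phi (r1 r2 r3 : R) (h : quat R) : tensor3 := fun i j k =>
  (r1 * r2 * r3) ^+ 3 * wedge12 (e_ 1) (e2_ 2 3) i j k
  + \sum_(a < 3)
      wedge12 (fun x : 'I_7 => r1 ^+ 2 / (r2 * r3) * Upsilon h a 0 * e_ 1 x
                      + r2 ^+ 2 / (r1 * r3) * Upsilon h a 1 * e_ 2 x
                      + r3 ^+ 2 / (r1 * r2) * Upsilon h a 2 * e_ 3 x)
              (omega a) i j k.

(* The metric induced by [phi r1 r2 r3 h], for every unit h *)
Definition metric (r1 r2 r3 : R) : 'M[R]_7 :=
  let s := (r1 * r2 * r3)^-1 in
  diag_mx (\row_(i < 7) [:: r1 ^+ 6; r2 ^+ 6; r3 ^+ 6; s; s; s; s]`_i).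

Definition Sp1 : set (quat R) := [set h : quat R | \sum_(k < 4) h 0 k ^+ 2 = 1].

Definition family_torsion_normsq (r1 r2 r3 : R) (h : quat R) : R :=
  normsq (metric r1 r2 r3) (full_torsion (metric r1 r2 r3) (phi r1 r2 r3 h)).

Definition family_energy (r1 r2 r3 : R) (h : quat R) : R :=
  energy (metric r1 r2 r3) (phi r1 r2 r3 h).

(* h is a critical point of E on the family: E has zero derivative at h along
   every curve of unit quaternions through h differentiable there. *)
Definition critical_in_family (r1 r2 r3 : R) (h : quat R) : Prop :=
  forall c : R -> 'rV[R]_4,
    (forall t, Sp1 (c t)) -> c 0 = h -> derivable c 0 1 ->
    is_derive (0 : R) (1 : R) (fun t => family_energy r1 r2 r3 (c t)) 0.

(** * Subsets of RP^3 and the critical set *)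

(* [h] = {h, -h}; RP^3 is the set of these pairs for unit h. *)
Definition cls (h : quat R) : set (quat R) := [set h; - h].

Definition RP3 : set (set (quat R)) := cls @` Sp1.

Definition S2 (k l m : 'I_4) : set (set (quat R)) :=
  cls @` [set h : quat R | Sp1 h /\ h 0 k ^+ 2 + h 0 l ^+ 2 + h 0 m ^+ 2 = 1].

Definition S1 (k l : 'I_4) : set (set (quat R)) :=
  cls @` [set h : quat R | Sp1 h /\ h 0 k ^+ 2 + h 0 l ^+ 2 = 1].

Definition NS (k : 'I_4) : set (set (quat R)) :=
  cls @` [set h : quat R | Sp1 h /\ (h 0 k = 1 \/ h 0 k = -1)].

Definition rhof (x y z : R) : R :=
  4 * ((x + z) / (x ^+ 6 * y ^+ 3 * z ^+ 6)) * (x ^+ 2 - x * z + z ^+ 2)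
  * (x ^+ 4 * y * z ^+ 4 + 2)
  * (x ^+ 6 + y ^+ 6 + z ^+ 6 - 2 * x ^+ 3 * z ^+ 3 - x ^+ 4 * y ^+ 7 * z ^+ 4).

Definition rho0 (r1 r2 r3 : R) : R := rhof r1 r2 r3.
Definition rho1 (r1 r2 r3 : R) : R := rhof r2 r3 r1.
Definition rho3 (r1 r2 r3 : R) : R := rhof r3 r1 r2.

(* The set A if P holds, and the empty set otherwise *)
Definition when (P : Prop) (A : set (set (quat R))) : set (set (quat R)) :=
  [set x | P /\ A x].

(* One member of the union for each condition on (r1, r2, r3), with the indices
   of the h_k relabelled by s; r1 = r2 = r3 = r^(1/3) means r = r1 ^+ 3. *)
Definition listed (r1 r2 r3 : R) (s : 'I_4 -> 'I_4) : set (set (quat R)) :=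
  let p0 := rho0 r1 r2 r3 in
  let p1 := rho1 r1 r2 r3 in
  let p3 := rho3 r1 r2 r3 in
  when [/\ r1 = r2, r2 = r3 & r1 ^+ 3 = 1] RP3
  `|` when [/\ r1 = r2, r2 = r3 & r1 ^+ 3 <> 1]
        (cls @` [set h : quat R | Sp1 h /\ h 0 (s 2) = 0]
         `|` cls @` [set h : quat R | [/\ h 0 (s 0) = 0, h 0 (s 1) = 0, h 0 (s 3) = 0
                              & h 0 (s 2) = 1 \/ h 0 (s 2) = -1]])
  `|` when (p0 = 0) (S1 (s 0) (s 2))
  `|` when (p1 = p3 /\ p3 <> 0) (S1 (s 1) (s 3))
  `|` when (p1 = 0 /\ p3 = 0) (S2 (s 1) (s 2) (s 3))
  `|` when [/\ p0 = p1, p1 = p3 & p3 <> 0] (S2 (s 0) (s 1) (s 3))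
  `|` when [/\ p0 = 0, p1 = 0 & p3 = 0] RP3
  `|` \bigcup_(k in [set: 'I_4]) NS (s k).

(* The relabelling h_0 -> h_1 -> h_3 -> h_0, h_2 -> h_2, which goes with
   (r1, r2, r3) -> (r2, r3, r1), that is rho_0 -> rho_1 -> rho_3 -> rho_0 *)
Definition relabel (k : 'I_4) : 'I_4 := nth 0 [:: 1; 3; 2; 0] k.

Definition critical_set (r1 r2 r3 : R) : set (set (quat R)) :=
  listed r1 r2 r3 id
  `|` listed r2 r3 r1 relabel
  `|` listed r3 r1 r2 (relabel \o relabel).

End Quaternion.

(* Main.v *)
Require Import Defs.
From mathcomp Require Import all_boot all_order all_algebra.
From mathcomp Require Import all_classical all_reals all_analysis.
From mathcomp Require Import ring lra.
Import Order.TTheory GRing.Theory Num.Theory.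
Import numFieldNormedType.Exports.
Local Open Scope classical_set_scope.
Local Open Scope ring_scope.

Set Implicit Arguments.
Unset Strict Implicit.
Unset Printing Implicit Defensive.

(** In a coframe orthonormal for the metric, [phi_(r,h)] becomes [phi_(1,h)] and
    the Levi-Civita connection becomes [B_ijk K_ijk], where [B] is the 3-form
    [2 e^123 + e^1 w_1 - e^2 w_2 + e^3 w_3] of the brackets and [K] takes only nine
    values: [A_a] (three vertical indices), [C_a] (derivative along the vertical
    [e_a]) and [D_a] (derivative along a horizontal vector).  The full torsion
    is the projection of the connection from [so(7)] to [R^7], that is
    [T_im = - (1/2) sum_jk B_ijk K_ijk phi_jkm].  For unit [h] this gives
    [|T|^2 = c + sum_k lam_k h_k^2], where [c] and [lam_k] depend only on the
    [r_i], with [lam_0 - lam_2 = rho_0], [lam_1 - lam_2 = rho_1] and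
    [lam_3 - lam_2 = rho_3].  Up to a nonzero factor, the vertical components of
    [div T] are the imaginary components of the conjugate of [h] times the
    quaternion [(lam_k h_k)_k], and its horizontal components vanish.  So
    harmonicity and criticality both say that [h] is an eigenvector of
    [diag(lam_0, ..., lam_3)], and the list in the theorem is the list of unit
    vectors in its eigenspaces. *)

(** * Polynomial expressions *)

Import Ring_polynom.

Notation expr := (PExpr BinNums.Z).

(* Simplifying constructors: most components of the tensors below vanish. *)
Definition addx (x y : expr) : expr :=
  match x, y with PEO, _ => y | _, PEO => x | _, _ => PEadd x y end.
Definition mulx (x y : expr) : expr :=
  match x, y with
  | PEO, _ => PEO | _, PEO => PEO | PEI, _ => y | _, PEI => x
  | _, _ => PEmul x y
  end.
Definition oppx (x : expr) : expr :=
  match x with PEO => PEO | _ => PEopp x end.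
Definition subx (x y : expr) : expr := addx x (oppx y).
Definition natx (n : nat) : expr := iter n (addx PEI) PEO.
Definition boolx (b : bool) : expr := if b then PEI else PEO.
Definition sumx (n : nat) (F : nat -> expr) : expr :=
  foldr (fun i => addx (F i)) PEO (iota 0 n).

(* Two rounds of rewriting by [rels] suffice below, where the rewritten variable has
   degree at most 4 and its square is what is rewritten. *)
Definition eqx (rels : seq (expr * expr)) (e1 e2 : expr) : bool :=
  let sub := norm_subst BinNums.Z0 (BinNums.Zpos BinNums.xH)
    BinInt.Z.add BinInt.Z.mul BinInt.Z.sub BinInt.Z.opp BinInt.Z.eqb
    (InitialRing.triv_div BinNums.Z0 (BinNums.Zpos BinNums.xH) BinInt.Z.eqb) 2
    (mk_monpol_list BinNums.Z0 (BinNums.Zpos BinNums.xH)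
    BinInt.Z.add BinInt.Z.mul BinInt.Z.sub BinInt.Z.opp BinInt.Z.eqb
    (InitialRing.triv_div BinNums.Z0 (BinNums.Zpos BinNums.xH) BinInt.Z.eqb)
    rels) in
  Peq BinInt.Z.eqb (sub e1) (sub e2).

Section Evaluation.
Variables (R : comPzRingType) (l : seq R).

Definition ev : expr -> R :=
  PEeval 0 1 +%R *%R (fun x y => x - y) -%R (fun n => (ssrZ.int_of_Z n)%:~R)
    id (fun x n => x ^+ BinNat.N.to_nat n) l.

Lemma ev_add x y : ev (addx x y) = ev x + ev y.
Proof.
by rewrite /addx; case: x => *; case: y => * /=; rewrite ?(add0r, addr0).
Qed.

Lemma ev_mul x y : ev (mulx x y) = ev x * ev y.
Proof.
by rewrite /mulx; case: x => *; case: y => * /=;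
  rewrite ?(mul0r, mulr0, mul1r, mulr1).
Qed.

Lemma ev_opp x : ev (oppx x) = - ev x.
Proof. by case: x => * /=; rewrite ?oppr0. Qed.

Lemma ev_sub x y : ev (subx x y) = ev x - ev y.
Proof. by rewrite ev_add ev_opp. Qed.

Lemma ev_nat n : ev (natx n) = n%:R.
Proof. by elim: n => // n IHn; rewrite /natx iterS ev_add IHn -natr1 addrC. Qed.

Lemma ev_bool b : ev (boolx b) = b%:R.
Proof. by case: b. Qed.

Lemma ev_sum n F : ev (sumx n F) = \sum_(i < n) ev (F i).
Proof.
rewrite /sumx -(big_mkord xpredT (fun i => ev (F i))) /index_iota subn0.
by elim: (iota 0 n) => [|i s IHs] /=; rewrite ?big_nil ?big_cons ?ev_add ?IHs.
Qed.

Definition evE := (ev_add, ev_mul, ev_opp, ev_sub, ev_nat, ev_bool, ev_sum).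

(** This is the soundness theorem of the normaliser behind [ring]: equal normal forms have equal
    values wherever the relations [rels] hold. *)
Lemma eqxP rels e1 e2 :
  interp_PElist 0 1 +%R *%R (fun x y => x - y) -%R eq
    (fun n : BinNums.Z => (ssrZ.int_of_Z n)%:~R)
    id (fun x n => x ^+ BinNat.N.to_nat n) l rels ->
  eqx rels e1 e2 -> ev e1 = ev e2.
Proof.
move=> rel_ok chk; exact: (@Internals.Rcorrect R 2%N l rels e1 e2 rel_ok chk).
Qed.

End Evaluation.
Arguments ev {R} l e : simpl never, rename.
Arguments addx : simpl never.
Arguments mulx : simpl never.
Arguments oppx : simpl never.
Arguments subx : simpl never.

(** Indices range over [nat] rather than ['I_7], so that a whole family of identities is a single
    closed boolean that evaluates without ordinals. *)
Definition all7 (P : nat -> bool) := all P (iota 0 7).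

Lemma all7P P : all7 P -> forall i : 'I_7, P i.
Proof. by move=> /allP allP i; apply: allP; rewrite mem_iota add0n ltn_ord. Qed.

(* The variables are numbered from 0: 0, ..., 3 stand for h_0, ..., h_3, and
   4, ..., 12 for the weights A_1, A_2, A_3, C_1, ..., D_3 of the connection, in
   the order of [weight_reps]. *)
Definition varx (n : nat) : expr := PEX BinNums.Z (BinPos.Pos.of_succ_nat n).

(** * Forms, connection and torsion as polynomial expressions *)

Definition wedge11x (a b : nat -> expr) (i j : nat) : expr :=
  subx (mulx (a i) (b j)) (mulx (a j) (b i)).
Definition wedge12x (a : nat -> expr) (w : nat -> nat -> expr) (i j k : nat) :=
  addx (addx (mulx (a i) (w j k)) (mulx (a j) (w k i))) (mulx (a k) (w i j)).
Definition wedge22x (v w : nat -> nat -> expr) (i j k l : nat) : expr :=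
  addx (addx (subx (mulx (v i j) (w k l)) (mulx (v i k) (w j l)))
             (mulx (v i l) (w j k)))
       (addx (subx (mulx (v k l) (w i j)) (mulx (v j l) (w i k)))
             (mulx (v j k) (w i l))).
Definition ex (k i : nat) : expr := boolx (i.+1 == k).
Definition e2x (k l : nat) := wedge11x (ex k) (ex l).
Definition omegax (a i j : nat) : expr :=
  match a with
  | 0 => addx (e2x 4 7 i j) (e2x 5 6 i j)
  | 1 => subx (e2x 4 6 i j) (e2x 5 7 i j)
  | _ => addx (e2x 4 5 i j) (e2x 6 7 i j)
  end.

Definition Upsilonx (a b : nat) : expr :=
  let h := varx in
  let sq k := mulx (h k) (h k) in
  let tw k l m n := mulx (natx 2) (addx (mulx (h k) (h l)) (mulx (h m) (h n))) in
  let tn k l m n := mulx (natx 2) (subx (mulx (h k) (h l)) (mulx (h m) (h n))) in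
  nth PEO (nth [::] [::
    [:: subx (subx (addx (sq 0) (sq 1)) (sq 2)) (sq 3); tn 1 2 0 3; tw 1 3 0 2];
    [:: tw 1 2 0 3; subx (addx (subx (sq 0) (sq 1)) (sq 2)) (sq 3); tn 2 3 0 1];
    [:: tn 1 3 0 2; tw 2 3 0 1; addx (subx (subx (sq 0) (sq 1)) (sq 2)) (sq 3)]]
    a) b.

Definition phix (i j k : nat) : expr :=
  addx (wedge12x (ex 1) (e2x 2 3) i j k)
    (sumx 3 (fun a => wedge12x
       (fun x => addx (addx (mulx (Upsilonx a 0) (ex 1 x))
                            (mulx (Upsilonx a 1) (ex 2 x)))
                      (mulx (Upsilonx a 2) (ex 3 x))) (omegax a) i j k)).

(** The Hodge dual of [phi_(1,h)] for the standard metric: [e^123] becomes [e^4567], and [e^1] wedge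
    [omega_a] becomes [e^23] wedge [omega_a], and so on cyclically, because the [omega_a] are
    self-dual on the horizontal 4-space. *)
Definition psix (i j k l : nat) : expr :=
  addx (wedge22x (e2x 4 5) (e2x 6 7) i j k l)
    (sumx 3 (fun a => wedge22x
       (fun x y => addx (addx (mulx (Upsilonx a 0) (e2x 2 3 x y))
                              (mulx (Upsilonx a 1) (e2x 3 1 x y)))
                        (mulx (Upsilonx a 2) (e2x 1 2 x y))) (omegax a) i j k l)).

Definition bracketx (i j k : nat) : expr :=
  addx (subx (addx (mulx (natx 2) (wedge12x (ex 1) (e2x 2 3) i j k))
    (wedge12x (ex 1) (omegax 0) i j k)) (wedge12x (ex 2) (omegax 1) i j k))
    (wedge12x (ex 3) (omegax 2) i j k).

(* The weight K_ijk is symmetric in j and k, and all horizontal indices are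
   equivalent: (minn 3 i, {minn 3 j, minn 3 k}) determines it. *)
Definition weight_reps : seq (nat * nat * nat) :=
  [:: (0, 1, 2); (1, 0, 2); (2, 0, 1); (0, 3, 3); (1, 3, 3); (2, 3, 3);
      (3, 0, 3); (3, 1, 3); (3, 2, 3)]%N.
Definition weight_rep (i j k : nat) : nat * nat * nat :=
  let f := minn 3 in (f i, minn (f j) (f k), maxn (f j) (f k)).
Definition conx (i j k : nat) : expr :=
  mulx (bracketx i j k) (varx (4 + index (weight_rep i j k) weight_reps)).
(** The factor [- 1/2] of the torsion is left out to keep integer coefficients. *)
Definition torsx (i m : nat) : expr :=
  sumx 7 (fun j => sumx 7 (fun k => mulx (conx i j k) (phix j k m))).

(* h_0^2 = 1 - h_1^2 - h_2^2 - h_3^2, as a rewriting rule on monomials *)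
Definition sphere : seq (expr * expr) :=
  [:: (PEpow (varx 0) (BinNums.Npos (BinNums.xO BinNums.xH)),
     subx (subx (subx PEI (mulx (varx 1) (varx 1)))
     (mulx (varx 2) (varx 2))) (mulx (varx 3) (varx 3)))].

Definition sgx (a b : nat) : expr :=
  if (b < a)%N then PEI else if (a < b)%N then oppx PEI else PEO.
Definition lcx (s : seq nat) : expr :=
  foldr (fun b => mulx (foldr (fun a => mulx (sgx (nth 0%N s b) (nth 0%N s a)))
    PEI (iota 0 b))) PEI (iota 0 (size s)).

Arguments wedge11x : simpl never.
Arguments wedge12x : simpl never.
Arguments e2x : simpl never.
Arguments ex : simpl never.
Arguments varx : simpl never.

(** * The bracket of [p] *)

(* Twice the components of the basis of p; the variable 0 is the square root of 2. *)
Definition basisx (i a b q : nat) : expr :=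
  if (i < 3)%N then mulx (natx 2) (boolx [&& a == 1, b == 1 & q == i.+1]%N)
  else mulx (mulx (if (i == 6%N) && (a == 1)%N then oppx PEI else PEI) (varx 0))
            (boolx ((a != b) && (q == if i == 6%N then 0 else i - 2)%N)).

Definition qmulx (x y : nat -> expr) (q : nat) : expr :=
  let xy a b := mulx (x a) (y b) in
  match q with
  | 0 => subx (subx (subx (xy 0 0) (xy 1 1)) (xy 2 2)) (xy 3 3)
  | 1 => subx (addx (addx (xy 0 1) (xy 1 0)) (xy 2 3)) (xy 3 2)
  | 2 => addx (addx (subx (xy 0 2) (xy 1 3)) (xy 2 0)) (xy 3 1)
  | _ => addx (subx (addx (xy 0 3) (xy 1 2)) (xy 2 1)) (xy 3 0)
  end.

Definition quat_bracketx (i j k : nat) : expr :=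
  sumx 2 (fun a => sumx 2 (fun b => sumx 4 (fun q => mulx (basisx k a b q)
    (subx (sumx 2 (fun c => qmulx (basisx i a c) (basisx j c b) q))
          (sumx 2 (fun c => qmulx (basisx j a c) (basisx i c b) q)))))).

Section Bracket.
Variable R : realType.

Lemma ev_basis (i : 'I_7) (a b : 'I_2) (q : 'I_4) :
  ev [:: Num.sqrt 2] (basisx i a b q) = 2 * basis_p R i a b 0 q.
Proof.
have s2 : 2 * (Num.sqrt 2)^-1 = Num.sqrt 2 :> R.
  by rewrite -{1}(sqr_sqrtr (ler0n R 2)) expr2 mulfK // sqrtr_eq0 -ltNge ltr0n.
rewrite /basis_p /basisx /mulx /ev;
case: i => -[|[|[|[|[|[|[|//]]]]]]] ?; rewrite !mxE /=;
case: a => -[|[|//]] ?; case: b => -[|[|//]] ?; rewrite /= ?mxE;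
case: q => -[|[|[|[|//]]]] ?; rewrite /= ?mxE /= ?mulr0 ?mulr1 ?mulrN ?s2 //;
  ring.
Qed.

Lemma ev_qmul (l : seq R) (X Y : nat -> expr) (x y : quat R) (q : 'I_4) :
  (forall p : 'I_4, ev l (X p) = 2 * x 0 p) ->
  (forall p : 'I_4, ev l (Y p) = 2 * y 0 p) ->
  ev l (qmulx X Y q) = 4 * (x * y) 0 q.
Proof.
move=> evX evY; rewrite [x * y]/(qmul x y).
move: (evX 0) (evX 1) (evX 2) (evX 3) (evY 0) (evY 1) (evY 2) (evY 3) => /=.
by case: q => -[|[|[|[|//]]]] ? X0 X1 X2 X3 Y0 Y1 Y2 Y3;
  rewrite !mxE /= !evE X0 X1 X2 X3 Y0 Y1 Y2 Y3; ring.
Qed.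

(** The bracket paired with [e_k] is trilinear in the three basis vectors, each of which is doubled
    in [basisx]; hence the factor 8. *)
Lemma ev_quat_bracket (i j k : 'I_7) :
  ev [:: Num.sqrt 2] (quat_bracketx i j k) = 8 * bracket_p R i j k.
Proof.
rewrite /bracket_p /sp2_dot ev_sum mulr_sumr; apply: eq_bigr => a _.
rewrite ev_sum mulr_sumr; apply: eq_bigr => b _.
rewrite ev_sum mulr_sumr; apply: eq_bigr => q _.
have prod (i' j' : 'I_7) :
  ev [:: Num.sqrt 2] (sumx 2 (fun c => qmulx (basisx i' a c) (basisx j' c b) q))
    = 4 * (basis_p R i' *m basis_p R j') a b 0 q.
  rewrite mxE ev_sum summxE mulr_sumr; apply: eq_bigr => c _.
  by apply: ev_qmul => p; apply: ev_basis.
rewrite ev_mul ev_sub !prod ev_basis /lie_bracket !mxE; ring.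
Qed.

Lemma quat_bracketxE : all7 (fun i => all7 (fun j => all7 (fun k =>
  eqx [:: (mulx (varx 0) (varx 0), natx 2)]
    (quat_bracketx i j k) (mulx (natx 8) (bracketx i j k))))).
Proof. exact_no_check (erefl true). Qed.

End Bracket.

(** Serves to clear integer denominators: [pnatr_inj _ n] multiplies both sides of a goal by
    [n + 1]. *)
Lemma pnatr_inj (R : numDomainType) (n : nat) : injective ( *%R n.+1%:R : R -> R).
Proof. by apply: mulfI; rewrite pnatr_eq0. Qed.

(** * Values of the expressions for the invariant forms *)

Section Forms.
Variables (R : realType) (l : seq R).
Local Notation ev := (ev l).

Lemma ev_var n : (n < 13)%N -> ev (varx n) = l`_n.
Proof.
do 13![case: n => [_|n];
  first by rewrite /ev /=; move: l; do 12?[case=> // ?]; case].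
by rewrite !ltnS ltn0.
Qed.

Lemma ev_wedge12 (ax : nat -> expr) (wx : nat -> nat -> expr)
    (a : 'I_7 -> R) (w : 'I_7 -> 'I_7 -> R) (i j k : 'I_7) :
  (forall x : 'I_7, ev (ax x) = a x) ->
  (forall x y : 'I_7, ev (wx x y) = w x y) ->
  ev (wedge12x ax wx i j k) = wedge12 a w i j k.
Proof. by move=> eva evw; rewrite /wedge12x /wedge12 !evE !eva !evw. Qed.

Lemma ev_e k (i : 'I_7) : ev (ex k i) = e_ R k i.
Proof. by rewrite evE. Qed.

Lemma ev_e2 k m (i j : 'I_7) : ev (e2x k m i j) = e2_ R k m i j.
Proof. by rewrite /e2x /wedge11x !evE. Qed.

Lemma ev_omega (a : 'I_3) (i j : 'I_7) : ev (omegax a i j) = omega R a i j.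
Proof.
by case: a => -[|[|[|//]]] ? /=; [rewrite ev_add|rewrite ev_sub|rewrite ev_add];
  rewrite !ev_e2.
Qed.

Definition bracket_form (i j k : 'I_7) : R :=
  2 * wedge12 (e_ R 1) (e2_ R 2 3) i j k + wedge12 (e_ R 1) (omega1 R) i j k
  - wedge12 (e_ R 2) (omega2 R) i j k + wedge12 (e_ R 3) (omega3 R) i j k.

Lemma ev_bracket_form (i j k : 'I_7) : ev (bracketx i j k) = bracket_form i j k.
Proof.
rewrite ev_add ev_sub ev_add ev_mul ev_nat; congr (2 * _ + _ - _ + _);
  apply: ev_wedge12 => // x *; rewrite ?ev_e2 ?ev_e //.
- exact: (ev_omega 0).
- exact: (ev_omega 1).
- exact: (ev_omega 2%:R).
Qed.

Lemma ev_Upsilon (h : quat R) (a b : 'I_3) : (forall k : 'I_4, l`_k = h 0 k) ->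
  ev (Upsilonx a b) = Upsilon h a b.
Proof.
move=> lh.
have [h0 h1 h2 h3] : [/\ l`_0 = h 0 0, l`_1 = h 0 1, l`_2 = h 0 2 & l`_3 = h 0 3].
  by split; rewrite -lh.
case: a => -[|[|[|//]]] ?; case: b => -[|[|[|//]]] ?; rewrite !mxE /= !evE !ev_var //;
  by rewrite ?h0 ?h1 ?h2 ?h3; ring.
Qed.

Lemma ev_phi (h : quat R) (i j k : 'I_7) : (forall k : 'I_4, l`_k = h 0 k) ->
  ev (phix i j k) = phi 1 1 1 h i j k.
Proof.
move=> lh; rewrite /phi /phix ev_add ev_sum !(expr1n, mul1r, invr1).
congr (_ + _).
  by apply: ev_wedge12 => *; rewrite ?ev_e ?ev_e2.
apply: eq_bigr => a _; apply: ev_wedge12 => x *; last by rewrite ev_omega.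
have evU (b : 'I_3) := ev_Upsilon a b lh.
by rewrite !ev_add !ev_mul !ev_e (evU 0) (evU 1) (evU 2%:R) !mul1r.
Qed.
End Forms.

Lemma bracket_pE (R : realType) (i j k : 'I_7) :
  bracket_p R i j k = bracket_form R i j k.
Proof.
apply: (@pnatr_inj _ 7); set l := [:: Num.sqrt 2 : R].
rewrite -ev_quat_bracket -(ev_bracket_form l).
transitivity (ev l (mulx (natx 8) (bracketx i j k))); last by rewrite ev_mul ev_nat.
apply: (@eqxP _ _ [:: (mulx (varx 0) (varx 0), natx 2)]).
  by rewrite /= -expr2 sqr_sqrtr ?ler0n.
exact: (all7P (all7P (all7P quat_bracketxE i) j) k).
Qed.

(** This reflects the ad-invariance of the inner product on [sp(2)]; here it is read off from the
    explicit 3-form. *)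
Lemma bracket_p_cyclic (R : realType) (i j k : 'I_7) :
  bracket_p R i j k = bracket_p R j k i.
Proof. by rewrite !bracket_pE /bracket_form /wedge12; ring. Qed.

Lemma ev_bracket (R : realType) (l : seq R) (i j k : 'I_7) :
  ev l (bracketx i j k) = bracket_p R i j k.
Proof. by rewrite bracket_pE ev_bracket_form. Qed.

(** * Diagonal metrics *)

Lemma levi_civita_nuniq (R : realType) (s : seq 'I_7) :
  ~~ uniq s -> levi_civita R s = 0.
Proof.
move=> /(uniqPn 0) [a [b [ltab ltbs eqab]]].
rewrite /levi_civita (bigD1 (Ordinal ltbs)) //= (bigD1 (Ordinal ltab)) //=.
by rewrite eqab subrr sgr0 !mul0r.
Qed.

(** Seven distinct indices exhaust ['I_7]. In the Hodge star this splits the volume factor over the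
    indices of a nonzero Levi-Civita symbol. *)
Lemma prod_uniq7 (R : comPzRingType) (d : 'I_7 -> R) (s : seq 'I_7) :
  uniq s -> size s = 7 -> \prod_(i <- s) d i = \prod_i d i.
Proof.
move=> us ss; rewrite big_uniq //; apply: eq_bigl => i.
have /subset_cardP/(_ (subset_predT _))/(_ i) -> // : #|s| = #|{: 'I_7}|.
by rewrite (card_uniqP us) ss card_ord.
Qed.

Section DiagonalMetric.
Variables (R : realType) (d : 'I_7 -> R).
Hypothesis d_gt0 : forall i, 0 < d i.
Let d_neq0 i : d i != 0. Proof. by rewrite gt_eqF. Qed.

Definition diag_metric : 'M[R]_7 := diag_mx (\row_i d i ^+ 2).
Local Notation g := diag_metric.

(** The Levi-Civita connection in the orthonormal frame [e_i / d i]: by the cyclic symmetry of the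
    bracket, Koszul's formula reduces to one bracket times the weight [K_ijk]. *)
Definition orth_con (i j k : 'I_7) : R :=
  bracket_p R i j k * ((d k ^+ 2 - d i ^+ 2 + d j ^+ 2) / (2 * d i * d j * d k)).

Lemma sum_diag_mx (v : 'rV[R]_7) (F : 'I_7 -> R) k :
  \sum_l F l * diag_mx v l k = F k * v 0 k.
Proof.
rewrite (bigD1 k) //= big1 ?addr0 => [|l /negPf lk]; rewrite !mxE ?eqxx //.
by rewrite lk mulr0.
Qed.

Lemma sum_diag_mxl (v : 'rV[R]_7) (F : 'I_7 -> R) k :
  \sum_l diag_mx v k l * F l = v 0 k * F k.
Proof.
by rewrite -tr_diag_mx [RHS]mulrC -sum_diag_mx; apply: eq_bigr => l _; rewrite mxE mulrC.
Qed.

Lemma invmx_diag_metric : invmx g = diag_mx (\row_i d i ^- 2).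
Proof.
have gK : diag_mx (\row_i d i ^- 2) *m g = 1%:M.
  rewrite mulmx_diag -diag_const_mx; congr diag_mx.
  by apply/rowP => i; rewrite !mxE mulVf // expf_neq0.
by rewrite -[LHS]mul1mx -gK mulmxK //; case/mulmx1_unit: gK.
Qed.

Lemma nabla_diag i j k : nabla g i j k = orth_con i j k * d i * d j / d k.
Proof.
rewrite /nabla invmx_diag_metric sum_diag_mx mxE.
rewrite big_split /= sumrB !sum_diag_mx !mxE /orth_con.
rewrite -(bracket_p_cyclic R i j k) (bracket_p_cyclic R k i j).
by field; rewrite !d_neq0.
Qed.

Lemma raise3_diag (F : tensor3 R) a b c :
  \sum_a' \sum_b' \sum_c' diag_mx (\row_i d i ^- 2) a a'
    * diag_mx (\row_i d i ^- 2) b b' * diag_mx (\row_i d i ^- 2) c c' * F a' b' c'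
  = d a ^- 2 * d b ^- 2 * d c ^- 2 * F a b c.
Proof.
under eq_bigr => a' _ do under eq_bigr => b' _ do
  (under eq_bigr do rewrite -mulrA; rewrite -mulr_sumr sum_diag_mxl).
under eq_bigr => a' _ do
  (under eq_bigr do rewrite -mulrA; rewrite -mulr_sumr sum_diag_mxl).
by rewrite sum_diag_mxl !mxE !mulrA.
Qed.

Section Tensors.
Variables (phi phi0 : tensor3 R).
Hypothesis phiE : forall i j k, phi i j k = d i * d j * d k * phi0 i j k.

(** The hypothesis [phiE] says that [phi0] gives the components of [phi] in the orthonormal frame;
    each covariant index then contributes one factor [d]. *)
Lemma nabla_form_diag i j k l : nabla_form g phi i j k l =
  - (d i * d j * d k * d l * \sum_m (orth_con i j m * phi0 m k l
    + orth_con i k m * phi0 j m l + orth_con i l m * phi0 j k m)).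
Proof.
rewrite /nabla_form mulr_sumr; congr (- _); apply: eq_bigr => m _.
by rewrite !nabla_diag !phiE; field; rewrite !d_neq0.
Qed.

Lemma sqrt_det_diag : Num.sqrt (\det g) = \prod_i d i.
Proof.
rewrite det_diag; under eq_bigr do rewrite mxE.
by rewrite prodrXl sqrtr_sqr ger0_norm // prodr_ge0 // => i _; rewrite ltW.
Qed.

Lemma hodge3_diag j k l m : hodge3 g phi j k l m =
  d j * d k * d l * d m / 6 * (\sum_a \sum_b \sum_c
    levi_civita R [:: a; b; c; j; k; l; m] * phi0 a b c).
Proof.
rewrite /hodge3 sqrt_det_diag invmx_diag_metric.
do 3! (rewrite [LHS]mulr_sumr [RHS]mulr_sumr; apply: eq_bigr => ? _).
set x := (X in levi_civita R (X :: _)); set y := (X in levi_civita R (_ :: X :: _)).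
set z := (X in levi_civita R (_ :: _ :: X :: _)).
rewrite raise3_diag phiE.
have [us|/levi_civita_nuniq ->] := boolP (uniq [:: x; y; z; j; k; l; m]);
  last by rewrite mul0r !mulr0.
(* The factors [d] of [x], [y], [z] occur once in the volume and once in [phi], and cancel against
   the inverse squares that raise these indices. *)
rewrite -(prod_uniq7 d us) // !big_cons big_nil.
by field; rewrite !d_neq0.
Qed.
End Tensors.

Section Bilinear.
Variables (T T0 : 'M[R]_7).
Hypothesis TE : forall i j, T i j = d i * d j * T0 i j.

Lemma nabla_bilin_diag k i j : nabla_bilin g T k i j =
  - (d k * d i * d j *
     \sum_m (orth_con k i m * T0 m j + orth_con k j m * T0 i m)).
Proof.
rewrite /nabla_bilin mulr_sumr; congr (- _); apply: eq_bigr => m _.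
by rewrite !nabla_diag !TE; field; rewrite !d_neq0.
Qed.

Lemma divergence_diag j : divergence g T j =
  - (d j * \sum_i \sum_m (orth_con i i m * T0 m j + orth_con i j m * T0 i m)).
Proof.
rewrite /divergence invmx_diag_metric mulr_sumr -sumrN; apply: eq_bigr => i _.
by rewrite sum_diag_mxl mxE nabla_bilin_diag; field; rewrite !d_neq0.
Qed.

Lemma normsq_diag : normsq g T = \sum_i \sum_j T0 i j ^+ 2.
Proof.
rewrite /normsq invmx_diag_metric; apply: eq_bigr => i _; apply: eq_bigr => j _.
under eq_bigr => k _ do under eq_bigr do rewrite -!mulrA.
under eq_bigr => k _ do rewrite -mulr_sumr sum_diag_mxl.
by rewrite sum_diag_mxl !mxE !TE; field; rewrite !d_neq0.
Qed.
End Bilinear.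
End DiagonalMetric.

(** * Polynomial identities between the components *)

(* The repeated tests only save computing terms whose Levi-Civita symbol is 0. *)
Definition hodgex (j k l m : nat) : expr :=
  if ~~ uniq [:: j; k; l; m] then PEO else
  sumx 7 (fun a => if ~~ uniq [:: a; j; k; l; m] then PEO else
  sumx 7 (fun b => if ~~ uniq [:: a; b; j; k; l; m] then PEO else
  sumx 7 (fun c => mulx (lcx [:: a; b; c; j; k; l; m]) (phix a b c)))).

(** The factor 6 counts the orderings of [a], [b], [c], which all give the same term. *)
Lemma hodgexE : all7 (fun j => all7 (fun k => all7 (fun l => all7 (fun m =>
  eqx [::] (hodgex j k l m) (mulx (natx 6) (psix j k l m)))))).
Proof. exact_no_check (erefl true). Qed.

Lemma phix_skew : all7 (fun i => all7 (fun j => all7 (fun k =>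
  eqx [::] (phix i j k) (oppx (phix j i k))
  && eqx [::] (phix i j k) (oppx (phix i k j))))).
Proof. exact_no_check (erefl true). Qed.

Lemma psix_skew : all7 (fun m => all7 (fun i => all7 (fun j => all7 (fun k =>
  eqx [::] (psix m i j k) (oppx (psix m j i k))
  && eqx [::] (psix m i j k) (oppx (psix m i k j)))))).
Proof. exact_no_check (erefl true). Qed.

(* Any j different from n will do; j = n would make the contraction vanish. *)
Lemma psix_gram : all7 (fun m => all7 (fun n =>
  let j := (n == 0%N : nat) in
  eqx sphere (sumx 7 (fun k => sumx 7 (fun l => mulx (psix m j k l) (psix n j k l))))
    (mulx (natx 4) (boolx (m == n))))).
Proof. exact_no_check (erefl true). Qed.

(** This is [- 2 nabla phi]; the factor matches the one by which [torsx] differs from the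
    torsion. *)
Definition nabla_phix (i j k l : nat) : expr :=
  mulx (natx 2) (sumx 7 (fun m => addx (addx (mulx (conx i j m) (phix m k l))
    (mulx (conx i k m) (phix j m l))) (mulx (conx i l m) (phix j k m)))).

(** The part of the connection in the Lie algebra of [G2] annihilates [phi], so that only its
    projection to [R^7] contributes, and this is the torsion. *)
Lemma nabla_phixE : all7 (fun i => all7 (fun j => all7 (fun k => all7 (fun l =>
  (j < k < l)%N ==> eqx sphere (nabla_phix i j k l)
    (sumx 7 (fun m => mulx (torsx i m) (psix m j k l))))))).
Proof. exact_no_check (erefl true). Qed.

(** Here [p = A_1 C_1 - D_2 D_3], [q = D_1 D_3 - A_2 C_2] and [s = A_3 C_3 - D_1 D_2]. The signs are
    those of the diagonal of [Upsilon]: the sum of [eigvalx k] times [h_k^2] is [p Upsilon_11 + q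
    Upsilon_22 + s Upsilon_33]. *)
Definition eigvalx (k : nat) : expr :=
  let p := subx (mulx (varx 4) (varx 7)) (mulx (varx 11) (varx 12)) in
  let q := subx (mulx (varx 10) (varx 12)) (mulx (varx 5) (varx 8)) in
  let s := subx (mulx (varx 6) (varx 9)) (mulx (varx 10) (varx 11)) in
  match k with
  | 0 => addx p (addx q s) | 1 => subx p (addx q s) | 2 => subx q (addx p s)
  | _ => subx s (addx p q)
  end.

(** The components are affine in the entries of [Upsilon], so their squares have degree 4 in [h].
    For unit [h] the matrix [Upsilon] is a rotation: its rows have length 1 and its minors are again
    entries. What remains is a constant and the diagonal entries. *)
Lemma normsq_torsx : eqx sphere
  (sumx 7 (fun i => sumx 7 (fun j => mulx (torsx i j) (torsx i j))))
  (addx (mulx (natx 16) (sumx 9 (fun k => mulx (varx (4 + k)) (varx (4 + k)))))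
    (mulx (natx 32) (sumx 4 (fun k => mulx (eigvalx k) (mulx (varx k) (varx k)))))).
Proof. exact_no_check (erefl true). Qed.

Definition skewx (k l : nat) : expr :=
  mulx (subx (eigvalx k) (eigvalx l)) (mulx (varx k) (varx l)).
Definition divx (j : nat) : expr :=
  match j with
  | 0 => addx (skewx 0 1) (skewx 3 2) | 1 => addx (skewx 0 2) (skewx 1 3)
  | 2 => addx (skewx 0 3) (skewx 2 1) | _ => PEO
  end.
(** The horizontal components vanish because the divergence is invariant and [Sp(1)] fixes no
    nonzero horizontal vector. *)
Lemma divergence_torsx : all7 (fun j => eqx sphere
  (sumx 7 (fun i => sumx 7 (fun m => addx (mulx (conx i i m) (torsx m j))
     (mulx (conx i j m) (torsx i m)))))
  (mulx (natx 8) (divx j))).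
Proof. exact_no_check (erefl true). Qed.

(** Outside [weight_reps], [index] points past the last weight; [conx] is still correct there
    because the bracket vanishes. *)
Lemma bracketx_rep : all7 (fun i => all7 (fun j => all7 (fun k =>
  (if bracketx i j k is PEO then true else weight_rep i j k \in weight_reps)))).
Proof. by []. Qed.

(** * The full torsion in an orthonormal coframe *)

Lemma sum_ord4 (V : nmodType) (F : 'I_4 -> V) :
  \sum_k F k = F 0 + F 1 + F 2%:R + F 3%:R.
Proof.
rewrite !big_ord_recl big_ord0 addr0 !addrA.
by congr (_ + _ + _ + _); congr F; apply: val_inj.
Qed.

Lemma ord4_ind (P : 'I_4 -> Prop) : P 0 -> P 1 -> P 2%:R -> P 3%:R -> forall k, P k.
Proof.
move=> P0 P1 P2 P3 -[[|[|[|[|//]]]] lt4].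
- by rewrite (_ : Ordinal _ = 0) //; apply: val_inj.
- by rewrite (_ : Ordinal _ = 1) //; apply: val_inj.
- by rewrite (_ : Ordinal _ = 2%:R) //; apply: val_inj.
- by rewrite (_ : Ordinal _ = 3%:R) //; apply: val_inj.
Qed.

Section Levi.
Variables (R : realType) (l : seq R).

Lemma ev_prod n (F : nat -> expr) :
  ev l (foldr (fun i => mulx (F i)) PEI (iota 0 n)) = \prod_(i < n) ev l (F i).
Proof.
rewrite -(big_mkord xpredT (fun i => ev l (F i))) /index_iota subn0.
by elim: (iota 0 n) => [|i s IHs] /=; rewrite ?big_nil ?big_cons ?ev_mul ?IHs.
Qed.

Lemma ev_sg a b : ev l (sgx a b) = (Num.sg (a%:Z - b%:Z))%:~R.
Proof.
rewrite /sgx; case: (ltngtP b a) => [ba|ab|->]; last by rewrite subrr sgr0.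
  by rewrite gtr0_sg // subr_gt0 ltz_nat.
by rewrite ev_opp ltr0_sg ?rmorphN // subr_lt0 ltz_nat.
Qed.

Lemma ev_lc (s : seq 'I_7) : ev l (lcx (map val s)) = levi_civita R s.
Proof.
rewrite /lcx /levi_civita ev_prod size_map rmorph_prod; apply: eq_bigr => b _.
rewrite ev_prod rmorph_prod; apply: eq_bigr => a _.
by rewrite ev_sg !(nth_map 0) // (ltn_trans (ltn_ord a)).
Qed.

End Levi.

Lemma skew3_eq0 (R : realDomainType) (F : 'I_7 -> 'I_7 -> 'I_7 -> R) :
  (forall i j k, F i j k = - F j i k) -> (forall i j k, F i j k = - F i k j) ->
  (forall i j k : 'I_7, (i < j < k)%N -> F i j k = 0) -> forall i j k, F i j k = 0.
Proof.
move=> s12 s23 F0.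
have diag (x : R) : x = - x -> x = 0 by lra.
have le12 (i j k : 'I_7) : (j < k)%N -> F i j k = 0.
  move=> jk; case: (ltngtP i j) => [ij|ji|/val_inj ij].
  - by rewrite F0 // ij.
  - rewrite s12; case: (ltngtP i k) => [ik|ki|/val_inj ik].
    + by rewrite F0 ?oppr0 // ji.
    + by rewrite s23 opprK F0 // jk.
    + by rewrite ik; apply/eqP; rewrite oppr_eq0; apply/eqP/diag/s23.
  - by rewrite ij; apply/diag/s12.
move=> i j k; case: (ltngtP j k) => [jk|kj|/val_inj jk].
- exact: le12.
- by rewrite s23 le12 ?oppr0.
- by rewrite jk; apply/diag/s23.
Qed.

Section Torsion.
Variables (R : realType) (d : 'I_7 -> R) (h : quat R).
Hypotheses (d_gt0 : forall i, 0 < d i).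
Hypothesis d_horiz : forall i : 'I_7, (3 <= i)%N -> d i = d 3%:R.
Hypothesis h_unit : Sp1 h.
Let d_neq0 i : d i != 0. Proof. by rewrite gt_eqF. Qed.

Definition con_weight (t : nat * nat * nat) : R :=
  let '(i, j, k) := t in let dn n := d (inord n) in
  (dn k ^+ 2 - dn i ^+ 2 + dn j ^+ 2) / (2 * dn i * dn j * dn k).

Definition env : seq R :=
  [:: h 0 0; h 0 1; h 0 2; h 0 3] ++ map con_weight weight_reps.

Lemma env_quat (k : 'I_4) : env`_k = h 0 k.
Proof.
by case: k => -[|[|[|[|//]]]] ? /=; congr (h 0 _); apply: val_inj.
Qed.

Lemma env_sphere : interp_PElist 0 1 +%R *%R (fun x y => x - y) -%R eq
    (fun n : BinNums.Z => (ssrZ.int_of_Z n)%:~R)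
    id (fun x n => x ^+ BinNat.N.to_nat n) env sphere.
Proof.
move: h_unit; rewrite /Sp1 /= sum_ord4 => <-.
by rewrite -!expr2 /BinPos.Pos.to_nat /=; ring.
Qed.

Lemma eqx_env e1 e2 : eqx sphere e1 e2 -> ev env e1 = ev env e2.
Proof. exact/eqxP/env_sphere. Qed.

Lemma d_minn (i : 'I_7) : d (inord (minn 3 i)) = d i.
Proof.
case: (leqP 3 i) => i3; last by rewrite inord_val.
by rewrite (d_horiz i3); congr d; apply: val_inj; rewrite /= inordK.
Qed.

Lemma ev_con (i j k : 'I_7) : ev env (conx i j k) = orth_con d i j k.
Proof.
rewrite /conx ev_mul ev_bracket /orth_con.
have := all7P (all7P (all7P bracketx_rep i) j) k.
rewrite -(ev_bracket env); set b := bracketx i j k => b_or_rep.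
have [->|rep_in] : ev env b = 0 \/ weight_rep i j k \in weight_reps.
- by case: b b_or_rep => *; [left|right..].
- by rewrite !mul0r.
congr (_ * _); rewrite ev_var; last by move: rep_in; rewrite -index_mem -(ltn_add2l 4).
rewrite -[env`_(4 + _)]/((map con_weight weight_reps)`_(index _ weight_reps)).
rewrite (nth_map (0, 0, 0)%N) ?index_mem // nth_index //.
rewrite /weight_rep /con_weight d_minn.
case: (leqP (minn 3 j) (minn 3 k)) => _; rewrite !d_minn //.
by field; rewrite !d_neq0.
Qed.

Local Notation phi0 := (phi 1 1 1 h).
Local Notation psi0 := (fun i j k l : nat => ev env (psix i j k l)).

Lemma ev_env_phi (i j k : 'I_7) : ev env (phix i j k) = phi0 i j k.
Proof. exact/ev_phi/env_quat. Qed.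

Lemma phi0_skew12 (i j k : 'I_7) : phi0 i j k = - phi0 j i k.
Proof.
have /andP[skew _] := all7P (all7P (all7P phix_skew i) j) k.
by rewrite -!ev_env_phi (@eqxP _ env [::] _ _ I skew) ev_opp.
Qed.

Lemma phi0_skew23 (i j k : 'I_7) : phi0 i j k = - phi0 i k j.
Proof.
have /andP[_ skew] := all7P (all7P (all7P phix_skew i) j) k.
by rewrite -!ev_env_phi (@eqxP _ env [::] _ _ I skew) ev_opp.
Qed.

Lemma psi0_skew23 (m i j k : 'I_7) : psi0 m i j k = - psi0 m j i k.
Proof.
have /andP[skew _] := all7P (all7P (all7P (all7P psix_skew m) i) j) k.
by rewrite (@eqxP _ env [::] _ _ I skew) ev_opp.
Qed.

Lemma psi0_skew34 (m i j k : 'I_7) : psi0 m i j k = - psi0 m i k j.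
Proof.
have /andP[_ skew] := all7P (all7P (all7P (all7P psix_skew m) i) j) k.
by rewrite (@eqxP _ env [::] _ _ I skew) ev_opp.
Qed.

Lemma psi0_gram (m n : 'I_7) : let j := (n == 0%N :> nat) : nat in
  \sum_(k < 7) \sum_(l < 7) psi0 m j k l * psi0 n j k l = 4 * (m == n)%:R.
Proof.
have := eqx_env (all7P (all7P psix_gram m) n).
rewrite ev_mul ev_nat ev_bool ev_sum => <-; apply: eq_bigr => k _.
by rewrite ev_sum; apply: eq_bigr => l _; rewrite ev_mul.
Qed.

Lemma ev_hodge (j k l m : 'I_7) : ev env (hodgex j k l m) =
  \sum_a \sum_b \sum_c levi_civita R [:: a; b; c; j; k; l; m] * phi0 a b c.
Proof.
have nuniq0 (s s' : seq 'I_7) :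
    subseq s s' -> ~~ uniq (map val s) -> levi_civita R s' = 0.
  move=> sub; rewrite (map_inj_uniq val_inj) => /negP nus.
  by apply: levi_civita_nuniq; apply/negP => us'; apply/nus/(subseq_uniq sub).
rewrite /hodgex; case: ifP => [nu|_].
  rewrite big1 // => a _; rewrite big1 // => b _; rewrite big1 // => c _.
  rewrite (nuniq0 [:: j; k; l; m]) ?mul0r //.
  exact: (suffix_subseq [:: a; b; c]).
rewrite ev_sum; apply: eq_bigr => a _; case: ifP => [nu|_].
  rewrite big1 // => b _; rewrite big1 // => c _.
  rewrite (nuniq0 [:: a; j; k; l; m]) ?mul0r //.
  exact: (cat_subseq (subseq_refl [:: a]) (suffix_subseq [:: b; c] _)).
rewrite ev_sum; apply: eq_bigr => b _; case: ifP => [nu|_].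
  rewrite big1 // => c _; rewrite (nuniq0 [:: a; b; j; k; l; m]) ?mul0r //.
  exact: (cat_subseq (subseq_refl [:: a; b]) (suffix_subseq [:: c] _)).
rewrite ev_sum; apply: eq_bigr => c _.
by rewrite ev_mul ev_env_phi -(ev_lc env [:: a; b; c; j; k; l; m]).
Qed.

Definition orth_torsion : 'M[R]_7 :=
  \matrix_(i, m) (- 2^-1 * \sum_j \sum_k orth_con d i j k * phi0 j k m).

Lemma ev_tors (i m : 'I_7) : ev env (torsx i m) = - 2 * orth_torsion i m.
Proof.
rewrite mxE mulrA mulrNN divff ?mul1r ?pnatr_eq0 // ev_sum.
apply: eq_bigr => j _; rewrite ev_sum; apply: eq_bigr => k _.
by rewrite ev_mul ev_con ev_env_phi.
Qed.

Lemma orth_torsionE (i j k l : 'I_7) :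
  \sum_m (orth_con d i j m * phi0 m k l + orth_con d i k m * phi0 j m l
    + orth_con d i l m * phi0 j k m)
  = - \sum_(m < 7) orth_torsion i m * psi0 m j k l.
Proof.
apply/eqP; rewrite -subr_eq0 opprK; apply/eqP.
(* Both sides are skew in [j], [k], [l], which leaves the increasing triples of [nabla_phixE]. *)
move: j k l; apply: skew3_eq0 => [j k l|j k l|j k l jkl].
- rewrite opprD -!sumrN; congr (_ + _); apply: eq_bigr => m _.
    by rewrite (phi0_skew12 m k l) (phi0_skew12 j m l) (phi0_skew12 j k m); ring.
  by rewrite psi0_skew23 mulrN.
- rewrite opprD -!sumrN; congr (_ + _); apply: eq_bigr => m _.
    by rewrite (phi0_skew23 m k l) (phi0_skew23 j m l) (phi0_skew23 j k m); ring.
  by rewrite psi0_skew34 mulrN.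
have /implyP/(_ jkl)/eqx_env := all7P (all7P (all7P (all7P nabla_phixE i) j) k) l.
rewrite ev_mul ev_nat !ev_sum => eq2; apply: (@pnatr_inj _ 1).
rewrite mulr0 mulrDr; apply/eqP; rewrite addr_eq0; apply/eqP.
transitivity (\sum_(m < 7) ev env (mulx (torsx i m) (psix m j k l))).
  rewrite -eq2; congr (_ * _); apply: eq_bigr => m _.
  by rewrite !ev_add; congr (_ + _ + _); rewrite ev_mul ev_con ev_env_phi.
by rewrite mulr_sumr -sumrN; apply: eq_bigr => m _; rewrite ev_mul ev_tors mulrA !mulNr.
Qed.

Variable phi : tensor3 R.
Hypothesis phiE : forall i j k, phi i j k = d i * d j * d k * phi0 i j k.

Lemma hodge3E (j k l m : 'I_7) : hodge3 (diag_metric d) phi j k l m =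
  d j * d k * d l * d m * psi0 j k l m.
Proof.
rewrite (hodge3_diag d_gt0 phiE) -ev_hodge.
rewrite (@eqxP _ env [::] _ _ I (all7P (all7P (all7P (all7P hodgexE j) k) l) m)).
by rewrite ev_mul ev_nat; move: (ev env _) => p; field.
Qed.

Lemma is_full_torsion_orth : is_full_torsion (diag_metric d) phi
  (\matrix_(i, j) (d i * d j * orth_torsion i j)).
Proof.
move=> i j k l; rewrite (nabla_form_diag d_gt0 phiE) orth_torsionE mulrN opprK.
rewrite mulr_sumr invmx_diag_metric //; apply: eq_bigr => m _.
by rewrite sum_diag_mx hodge3E !mxE; move: (ev env _) => p; field; rewrite d_neq0.
Qed.

(** Existence is [is_full_torsion_orth]; uniqueness holds because contraction with [psi] is
    injective on vectors. *)
Lemma full_torsionE : full_torsion (diag_metric d) phi =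
  \matrix_(i, j) (d i * d j * orth_torsion i j).
Proof.
apply: xget_unique => [|T T_tors]; first exact: is_full_torsion_orth.
set T0 := \matrix_(_, _) _; apply/matrixP => i n.
have psi_ker (j k l : 'I_7) : \sum_(m < 7) (T i m - T0 i m) / d m * psi0 m j k l = 0.
  apply: (mulIf (_ : d j * d k * d l != 0)); first by rewrite !mulf_neq0.
  rewrite mul0r -[RHS](subrr (nabla_form (diag_metric d) phi i j k l)).
  rewrite {1}T_tors is_full_torsion_orth -sumrB mulr_suml invmx_diag_metric //.
  apply: eq_bigr => m _.
  by rewrite !sum_diag_mx hodge3E; move: (ev env _) (T i m) (T0 i m) => p t t0;
    rewrite !mxE; field; rewrite d_neq0.
(* A second contraction with [psi n j], for one fixed [j] other than [n], isolates the component [n]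
   by [psi0_gram]. *)
pose j : 'I_7 := inord (n == 0%N :> nat).
have jE : (n == 0%N :> nat) = j :> nat by rewrite inordK //; case: eqP.
have : \sum_(m < 7) (T i m - T0 i m) / d m *
    (\sum_(k < 7) \sum_(l < 7) psi0 m j k l * psi0 n j k l) = 0.
  under eq_bigr => m _ do rewrite mulr_sumr.
  rewrite exchange_big big1 //= => k _.
  under eq_bigr => m _ do rewrite mulr_sumr.
  rewrite exchange_big big1 //= => l _.
  under eq_bigr => m _ do rewrite mulrA.
  by rewrite -mulr_suml psi_ker mul0r.
rewrite -jE; under eq_bigr => m _ do rewrite psi0_gram.
rewrite (bigD1 n) //= big1 ?addr0 => [|m /negPf ->]; last by rewrite !mulr0.
rewrite eqxx mulr1 => /eqP; rewrite !mulf_eq0 invr_eq0 subr_eq0.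
by rewrite (negPf (d_neq0 n)) pnatr_eq0 !orbF => /eqP.
Qed.

Lemma normsq_full_torsion :
  normsq (diag_metric d) (full_torsion (diag_metric d) phi) =
  4 * (\sum_(k < 9) env`_(4 + k) ^+ 2)
  + 8 * \sum_(k < 4) ev env (eigvalx k) * h 0 k ^+ 2.
Proof.
rewrite full_torsionE (normsq_diag d_gt0 (T0 := orth_torsion));
  last by move=> *; rewrite mxE.
have := eqx_env normsq_torsx.
rewrite ev_add ev_mul [ev env (mulx (natx 32) _)]ev_mul !ev_nat !ev_sum => eq4.
(* As [torsx] is [- 2] times the torsion, [normsq_torsx] computes [4 |T|^2]. *)
apply: (@pnatr_inj _ 3).
transitivity (\sum_(i < 7) ev env (sumx 7 (fun j => mulx (torsx i j) (torsx i j)))).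
  rewrite mulr_sumr; apply: eq_bigr => i _.
  rewrite mulr_sumr ev_sum; apply: eq_bigr => j _.
  by rewrite ev_mul ev_tors; ring.
rewrite eq4 mulrDr !mulrA -!natrM; congr (_ * _ + _ * _); apply: eq_bigr => k _.
  by rewrite ev_mul ev_var ?expr2 // (ltn_add2l 4 _ 9).
by rewrite !ev_mul ev_var ?(leq_trans (ltn_ord k)) // env_quat expr2.
Qed.

Lemma divergence_full_torsion (j : 'I_7) :
  divergence (diag_metric d) (full_torsion (diag_metric d) phi) j =
  4 * d j * ev env (divx j).
Proof.
rewrite full_torsionE (divergence_diag d_gt0 (T0 := orth_torsion));
  last by move=> *; rewrite mxE.
have := eqx_env (all7P divergence_torsx j).
rewrite ev_mul ev_nat ev_sum => eq8; apply: (@pnatr_inj _ 1).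
transitivity (d j * \sum_(i < 7) ev env (sumx 7 (fun m =>
    addx (mulx (conx i i m) (torsx m j)) (mulx (conx i j m) (torsx i m)))));
  last by rewrite eq8; ring.
rewrite mulrN mulrCA -mulrN; congr (_ * _); rewrite mulr_sumr -sumrN.
apply: eq_bigr => i _; rewrite ev_sum mulr_sumr -sumrN; apply: eq_bigr => m _.
rewrite ev_add [ev env (mulx (conx i i m) _)]ev_mul.
by rewrite [ev env (mulx (conx i j m) _)]ev_mul !ev_con !ev_tors; ring.
Qed.

End Torsion.

(** * The metrics of the family *)

Arguments con_weight : simpl never.

Lemma wedge11_scale (R : realType) (d a b : 'I_7 -> R) p q i j :
  (forall x, d x * a x = p * a x) -> (forall x, d x * b x = q * b x) ->
  d i * d j * wedge11 a b i j = p * q * wedge11 a b i j.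
Proof.
move=> da db; rewrite /wedge11.
transitivity ((d i * a i) * (d j * b j) - (d j * a j) * (d i * b i)); first by ring.
by rewrite !da !db; ring.
Qed.

Lemma wedge12_scale (R : realType) (d a a' : 'I_7 -> R) w p i j k :
  (forall x y, d x * d y * w x y = p * w x y) ->
  (forall x, a' x = p * (d x * a x)) ->
  wedge12 a' w i j k = d i * d j * d k * wedge12 a w i j k.
Proof.
move=> dw a'E.
have T x y z : a' x * w y z = d x * a x * (d y * d z * w y z).
  by rewrite dw a'E; ring.
by rewrite /wedge12 !T; ring.
Qed.

Section Frame.
Variables (R : realType) (r1 r2 r3 : R).
Hypotheses (r1_gt0 : 0 < r1) (r2_gt0 : 0 < r2) (r3_gt0 : 0 < r3).
Local Notation s := ((r1 * r2 * r3)^-1).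

Definition frame (i : 'I_7) : R :=
  let u := Num.sqrt s in [:: r1 ^+ 3; r2 ^+ 3; r3 ^+ 3; u; u; u; u]`_i.

Let s_gt0 : 0 < s. Proof. by rewrite invr_gt0 !mulr_gt0. Qed.

Let sqr_u : Num.sqrt s * Num.sqrt s = s.
Proof. by rewrite -expr2 sqr_sqrtr ?ltW. Qed.

Lemma frame_gt0 i : 0 < frame i.
Proof.
by case: i => -[|[|[|[|[|[|[|//]]]]]]] ?; rewrite /frame /= ?exprn_gt0 ?sqrtr_gt0.
Qed.

Lemma frame_horiz (i : 'I_7) : (3 <= i)%N -> frame i = frame 3%:R.
Proof. by case: i => -[|[|[|[|[|[|[|//]]]]]]]. Qed.

Lemma metricE : metric r1 r2 r3 = diag_metric frame.
Proof.
congr diag_mx; apply/rowP => i; rewrite !mxE /frame.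
by case: i => -[|[|[|[|[|[|[|//]]]]]]] ? /=; rewrite -?exprM // sqr_sqrtr ?ltW.
Qed.

Lemma frame_e1 i : frame i * e_ R 1 i = r1 ^+ 3 * e_ R 1 i.
Proof.
by case: i => -[|[|[|[|[|[|[|//]]]]]]] ?; rewrite /frame /e_ /= ?mulr0.
Qed.

Lemma frame_e2 i : frame i * e_ R 2 i = r2 ^+ 3 * e_ R 2 i.
Proof.
by case: i => -[|[|[|[|[|[|[|//]]]]]]] ?; rewrite /frame /e_ /= ?mulr0.
Qed.

Lemma frame_e3 i : frame i * e_ R 3 i = r3 ^+ 3 * e_ R 3 i.
Proof.
by case: i => -[|[|[|[|[|[|[|//]]]]]]] ?; rewrite /frame /e_ /= ?mulr0.
Qed.

Lemma frame_omega a i j : frame i * frame j * omega R a i j = s * omega R a i j.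
Proof.
have frame_e k x : (3 < k)%N -> frame x * e_ R k x = Num.sqrt s * e_ R k x.
  move=> k3; case: (leqP 3 x) => x3; first by rewrite frame_horiz.
  rewrite /e_ (_ : _ == k = false) ?mulr0 //; apply/eqP => xk.
  by rewrite -xk ltnNge x3 in k3.
have frame_e2_ k m : (3 < k)%N -> (3 < m)%N ->
    frame i * frame j * e2_ R k m i j = s * e2_ R k m i j.
  by move=> k3 m3; rewrite -[s]sqr_u; apply: wedge11_scale => x; apply: frame_e.
case: a => -[|[|[|//]]] ?; rewrite /omega /=.
- by rewrite /omega1 !(mulrDr _ (e2_ R 4 7 i j)) !frame_e2_.
- by rewrite /omega2 !(mulrBr _ (e2_ R 4 6 i j)) !frame_e2_.
- by rewrite /omega3 !(mulrDr _ (e2_ R 4 5 i j)) !frame_e2_.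
Qed.

(** The coefficient [r1^2 / (r2 r3)] is [r1^3] times [1 / (r1 r2 r3)], that is the length of [e_1]
    times the squared length of a horizontal [e_i]; likewise for the other two. *)
Lemma phi_frame h i j k :
  phi r1 r2 r3 h i j k = frame i * frame j * frame k * phi 1 1 1 h i j k.
Proof.
rewrite /phi [RHS]mulrDr; congr (_ + _).
  rewrite !mul1r expr1n mul1r -(@wedge12_scale _ frame _
    (fun x => (r1 * r2 * r3) ^+ 3 * e_ R 1 x) _ (r2 ^+ 3 * r3 ^+ 3)) => [|x y|x].
  - by rewrite /wedge12; ring.
  - exact: wedge11_scale frame_e2 frame_e3.
  - by rewrite frame_e1; ring.
rewrite [RHS]mulr_sumr; apply: eq_bigr => a _.
apply: (@wedge12_scale _ _ _ _ _ s) => [x y|x]; first exact: frame_omega.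
rewrite [frame x * _](_ : _ = Upsilon h a 0 * (frame x * e_ R 1 x)
  + Upsilon h a 1 * (frame x * e_ R 2 x) + Upsilon h a 2 * (frame x * e_ R 3 x));
  last by field.
by rewrite frame_e1 frame_e2 frame_e3; field; rewrite !gt_eqF.
Qed.

Lemma sqrt_det_metric_gt0 : 0 < Num.sqrt (\det (metric r1 r2 r3)).
Proof.
rewrite metricE sqrt_det_diag; last exact: frame_gt0.
by apply: prodr_gt0 => i _; apply: frame_gt0.
Qed.

(** Only weights occur in [eigvalx], so the environment may be taken at the quaternion 0. The factor
    8 makes these the coefficients of [h_k^2] in [|T|^2]. *)
Definition eigval (k : nat) : R := 8 * ev (env frame 0) (eigvalx k).

Lemma eigvalE h k : 8 * ev (env frame h) (eigvalx k) = eigval k.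
Proof. by case: k => [|[|[|k]]]. Qed.

Let frameE n (n7 : (n < 7)%N) :
  frame (inord n) = let u := Num.sqrt s in
    [:: r1 ^+ 3; r2 ^+ 3; r3 ^+ 3; u; u; u; u]`_n.
Proof. by rewrite /frame inordK. Qed.

Let weight_vert i j k (i3 : (i < 3)%N) (j3 : (j < 3)%N) (k3 : (k < 3)%N) :
  let r n := [:: r1; r2; r3]`_n in
  con_weight frame (i, j, k) =
  (r k ^+ 6 - r i ^+ 6 + r j ^+ 6) / (2 * (r i * r j * r k) ^+ 3).
Proof.
have r3E n : (n < 3)%N -> frame (inord n) = [:: r1; r2; r3]`_n ^+ 3.
  by case: n => [|[|[|//]]] _; rewrite /frame inordK.
by rewrite /con_weight !r3E // -!exprM !exprMn !mulrA.
Qed.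

Let prodr_u : r1 * r2 * r3 = (Num.sqrt s * Num.sqrt s)^-1.
Proof. by rewrite sqr_u invrK. Qed.
Let u_gt0 : 0 < Num.sqrt s. Proof. by rewrite sqrtr_gt0. Qed.

Let weight_C i (i3 : (i < 3)%N) : let r := [:: r1; r2; r3]`_i in
  con_weight frame (i, 3, 3)%N = r ^- 3 - r ^+ 3 * (r1 * r2 * r3) / 2.
Proof.
have r3E : frame (inord i) = [:: r1; r2; r3]`_i ^+ 3.
  by case: i i3 => [|[|[|//]]] _; rewrite /frame inordK.
have : 0 < [:: r1; r2; r3]`_i by case: i i3 {r3E} => [|[|[|//]]].
move=> r_gt0 r; rewrite /con_weight r3E frameE //= -/r.
(* With [r1 r2 r3] written as [u^(-2)] the identity is rational in [u] and [r]. *)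
by move: (Num.sqrt s) u_gt0 prodr_u => u u0 ->; field; rewrite !gt_eqF.
Qed.

Let weight_D i (i3 : (i < 3)%N) : let r := [:: r1; r2; r3]`_i in
  con_weight frame (3, i, 3)%N = r ^+ 3 * (r1 * r2 * r3) / 2.
Proof.
have r3E : frame (inord i) = [:: r1; r2; r3]`_i ^+ 3.
  by case: i i3 => [|[|[|//]]] _; rewrite /frame inordK.
have : 0 < [:: r1; r2; r3]`_i by case: i i3 {r3E} => [|[|[|//]]].
move=> r_gt0 r; rewrite /con_weight r3E frameE //= -/r.
by move: (Num.sqrt s) u_gt0 prodr_u => u u0 ->; field; rewrite !gt_eqF.
Qed.

Lemma eigval_rho :
  [/\ eigval 0 - eigval 2 = rho0 r1 r2 r3, eigval 1 - eigval 2 = rho1 r1 r2 r3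
    & eigval 3 - eigval 2 = rho3 r1 r2 r3].
Proof.
rewrite /eigval /ev /= !(weight_C, weight_D, weight_vert) //=.
rewrite /rho0 /rho1 /rho3 /rhof.
by split; field; rewrite !gt_eqF.
Qed.
End Frame.

(** * Critical points of a diagonal quadratic form on the sphere *)

Section Eigenvectors.
Variables (R : realType) (lam : 'I_4 -> R).

(** An eigenvector of the diagonal matrix [lam], without naming the eigenvalue: nonzero coordinates
    have equal [lam]. *)
Definition eigvec (h : quat R) : Prop :=
  forall k l, (lam k - lam l) * (h 0 k * h 0 l) = 0.

Lemma Sp1P (h : quat R) :
  Sp1 h -> h 0 0 ^+ 2 + h 0 1 ^+ 2 + h 0 2%:R ^+ 2 + h 0 3%:R ^+ 2 = 1.
Proof. by rewrite /Sp1 /= sum_ord4. Qed.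

(** On a unit vector the eigenvalue has to be the value of the quadratic form. *)
Lemma eigvecP (h : quat R) : Sp1 h ->
  eigvec h <-> forall k, (lam k - \sum_l lam l * h 0 l ^+ 2) * h 0 k = 0.
Proof.
move=> h1; split=> [eig k|eig k l]; last first.
  transitivity ((lam k - \sum_l lam l * h 0 l ^+ 2) * h 0 k * h 0 l
    - (lam l - \sum_l lam l * h 0 l ^+ 2) * h 0 l * h 0 k); first by ring.
  by rewrite !eig !mul0r subrr.
have h1' : \sum_l h 0 l ^+ 2 = 1 by exact: h1.
rewrite -[lam k]mulr1 -h1' mulr_sumr -sumrB mulr_suml big1 // => l _.
transitivity ((lam k - lam l) * (h 0 k * h 0 l) * h 0 l); first by ring.
by rewrite eig mul0r.
Qed.

(** The three equations say that the conjugate of [h] times [(lam_k h_k)_k] is real. Left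
    multiplication by the unit [h] then shows that [(lam_k h_k)_k] is a real multiple of [h]; its
    coefficients are the arguments of [comb]. *)
Lemma eigvec_quat (h : quat R) : Sp1 h ->
  let m k l := (lam k - lam l) * (h 0 k * h 0 l) in
  eigvec h <-> [/\ m 0 1 + m 3%:R 2%:R = 0, m 0 2%:R + m 1 3%:R = 0
    & m 0 3%:R + m 2%:R 1 = 0].
Proof.
move=> h1 m; split=> [eig|[m1 m2 m3]]; first by rewrite /m !eig !addr0.
apply/eigvecP => //; rewrite sum_ord4.
have e0 : h 0 0 ^+ 2 = 1 - h 0 1 ^+ 2 - h 0 2%:R ^+ 2 - h 0 3%:R ^+ 2.
  by rewrite -(Sp1P h1); ring.
have comb k a b c : (lam k - (lam 0 * h 0 0 ^+ 2 + lam 1 * h 0 1 ^+ 2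
      + lam 2%:R * h 0 2%:R ^+ 2 + lam 3%:R * h 0 3%:R ^+ 2)) * h 0 k
    = a * (m 0 1 + m 3%:R 2%:R) + b * (m 0 2%:R + m 1 3%:R)
      + c * (m 0 3%:R + m 2%:R 1) ->
  (lam k - (lam 0 * h 0 0 ^+ 2 + lam 1 * h 0 1 ^+ 2
      + lam 2%:R * h 0 2%:R ^+ 2 + lam 3%:R * h 0 3%:R ^+ 2)) * h 0 k = 0.
  by move=> ->; rewrite m1 m2 m3 !mulr0 !addr0.
apply: ord4_ind.
- by apply: (comb _ (h 0 1) (h 0 2%:R) (h 0 3%:R)); rewrite /m; ring: e0.
- by apply: (comb _ (- h 0 0) (h 0 3%:R) (- h 0 2%:R)); rewrite /m; ring: e0.
- by apply: (comb _ (- h 0 3%:R) (- h 0 0) (h 0 1)); rewrite /m; ring: e0.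
- by apply: (comb _ (h 0 2%:R) (- h 0 1) (- h 0 0)); rewrite /m; ring: e0.
Qed.

End Eigenvectors.

(** The centre [x] is 0 along rotations, and the point [h] itself in the converse, where the
    derivative vanishes. *)
Lemma is_derive_quadratic (R : realType) (K C : R) (lam x v : 'I_4 -> R)
    (g : 'I_4 -> R -> R) :
  (forall k, is_derive (0 : R) (1 : R) (g k) (v k)) ->
  is_derive (0 : R) (1 : R) (fun t => K * (C + \sum_k lam k * (g k t - x k) ^+ 2))
    (K * \sum_k lam k * (2 * (g k 0 - x k) * v k)).
Proof.
move=> dg.
rewrite (_ : (fun t => _) =
    K \*: (cst C + \sum_k (lam k \*: (g k - cst (x k)) ^+ 2))); last first.
  by apply/funext => t /=; rewrite !fctE fct_sumE.
apply: is_derive_eq.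
rewrite /GRing.scale /= add0r; congr (_ * _); apply: eq_bigr => k _.
by rewrite subr0.
Qed.

(** * Rotations of a coordinate plane as test curves *)

Section Rotation.
Variables (R : realType) (h : quat R) (k l : 'I_4).
Hypothesis kl : k != l.

Definition rotation (t : R) : 'rV[R]_4 := \row_j
  (if j == k then cos t * h 0 k - sin t * h 0 l
   else if j == l then sin t * h 0 k + cos t * h 0 l else h 0 j).

Let lk : l == k = false. Proof. by rewrite eq_sym (negPf kl). Qed.

Lemma rotation0 : rotation 0 = h.
Proof.
apply/rowP => j; rewrite mxE cos0 sin0 !mul0r !mul1r subr0 add0r.
by case: eqP => [->//|_]; case: eqP => [->|].
Qed.

Lemma rotation_Sp1 t : Sp1 h -> Sp1 (rotation t).
Proof.
rewrite /Sp1 /= => <-; rewrite (bigD1 k) //= (bigD1 l) ?lk //=.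
rewrite [RHS](bigD1 k) //= [X in _ = _ + X](bigD1 l) ?lk //= !addrA; congr (_ + _).
  rewrite !mxE !eqxx lk.
  have e : cos t ^+ 2 = 1 - sin t ^+ 2 by rewrite -(cos2Dsin2 t) addrK.
  by ring: e.
by apply: eq_bigr => j /andP[/negPf jk /negPf jl]; rewrite mxE jk jl.
Qed.

Lemma is_derive_rotation j : is_derive (0 : R) (1 : R) (fun t => rotation t 0 j)
  (if j == k then - h 0 l else if j == l then h 0 k else 0).
Proof.
have ds := is_derive_sin (0 : R); have dc := is_derive_cos (0 : R).
rewrite (_ : (fun t => _) = if j == k then h 0 k \*: cos - h 0 l \*: sin
   else if j == l then h 0 k \*: sin + h 0 l \*: cos else cst (h 0 j)); last first.
  apply/funext => t; rewrite mxE; case: eqP => _ /=.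
    by rewrite !fctE /= /GRing.scale /= ![h _ _ * _]mulrC.
  by case: eqP => _ //=; rewrite !fctE /= /GRing.scale /= ![h _ _ * _]mulrC.
case: eqP => _; [|case: eqP => _]; apply: is_derive_eq => //;
  rewrite cos0 sin0 /GRing.scale /=; ring.
Qed.

Lemma derivable_rotation : derivable rotation 0 1.
Proof.
apply/derivable_mxP => i j; rewrite (ord1 i).
by have dj := is_derive_rotation j; exact: ex_derive.
Qed.
End Rotation.

(** * Harmonicity and criticality in the isometric family *)

Section Family.
Variables (R : realType) (r1 r2 r3 : R).
Hypotheses (r1_gt0 : 0 < r1) (r2_gt0 : 0 < r2) (r3_gt0 : 0 < r3).
Local Notation d := (frame r1 r2 r3).
Local Notation lam := (fun k : 'I_4 => eigval r1 r2 r3 k).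

Definition normsq_offset : R := 4 * \sum_(k < 9) (env d 0)`_(4 + k) ^+ 2.

Lemma family_normsqE h : Sp1 h ->
  family_torsion_normsq r1 r2 r3 h = normsq_offset + \sum_k lam k * h 0 k ^+ 2.
Proof.
move=> h1; have d_gt0 := frame_gt0 r1_gt0 r2_gt0 r3_gt0.
rewrite /family_torsion_normsq (metricE r1_gt0 r2_gt0 r3_gt0).
rewrite (normsq_full_torsion d_gt0 (@frame_horiz _ _ _ _) h1
  (phi_frame r1_gt0 r2_gt0 r3_gt0 h)).
congr (_ + _); rewrite mulr_sumr; apply: eq_bigr => k _.
by rewrite mulrA -(eigvalE _ _ _ h).
Qed.

Lemma harmonicP h : Sp1 h ->
  harmonic_G2 (metric r1 r2 r3) (phi r1 r2 r3 h) <-> eigvec lam h.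
Proof.
move=> h1; have d_gt0 := frame_gt0 r1_gt0 r2_gt0 r3_gt0.
rewrite /harmonic_G2 (metricE r1_gt0 r2_gt0 r3_gt0).
have divE := divergence_full_torsion d_gt0 (@frame_horiz _ _ _ _) h1
  (phi_frame r1_gt0 r2_gt0 r3_gt0 h).
have skewE (k l : 'I_4) : ev (env d h) (skewx k l)
    = 8^-1 * ((lam k - lam l) * (h 0 k * h 0 l)).
  rewrite /skewx !ev_mul ev_sub -!(eigvalE _ _ _ h) !ev_var ?(leq_trans (ltn_ord _)) //.
  by rewrite !env_quat; field.
rewrite eigvec_quat //; split=> [div0|[m1 m2 m3] j].
  have divx0 (j : 'I_7) : ev (env d h) (divx j) = 0.
    have /eqP := div0 j; rewrite divE !mulf_eq0 pnatr_eq0 /=.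
    by rewrite (gt_eqF (d_gt0 j)) /= => /eqP.
  move: (divx0 0) (divx0 1) (divx0 2%:R) => /=; rewrite !ev_add.
  rewrite (skewE 0 1) (skewE 3%:R 2%:R) (skewE 0 2%:R) (skewE 1 3%:R).
  rewrite (skewE 0 3%:R) (skewE 2%:R 1) -!mulrDr.
  have inv8 x : 8^-1 * x = 0 -> x = 0 :> R.
    by move/eqP; rewrite mulf_eq0 invr_eq0 pnatr_eq0 => /eqP.
  by move=> /inv8 ? /inv8 ? /inv8 ?.
rewrite divE [X in _ * X](_ : _ = 0) ?mulr0 //.
case: j => -[|[|[|j]]] lt_j7 //=; rewrite ev_add.
- by rewrite (skewE 0 1) (skewE 3%:R 2%:R) -mulrDr m1 mulr0.
- by rewrite (skewE 0 2%:R) (skewE 1 3%:R) -mulrDr m2 mulr0.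
- by rewrite (skewE 0 3%:R) (skewE 2%:R 1) -mulrDr m3 mulr0.
Qed.

Let vol : R := 2^-1 * (Num.sqrt (\det (metric r1 r2 r3)) * coframe_volume R).

Let vol_neq0 : vol != 0.
Proof.
rewrite !mulf_neq0 ?invr_eq0 ?pnatr_eq0 ?expf_neq0 ?gt_eqF ?pi_gt0 //.
exact: sqrt_det_metric_gt0.
Qed.

Lemma family_energyE h : Sp1 h ->
  family_energy r1 r2 r3 h = vol * (normsq_offset + \sum_k lam k * h 0 k ^+ 2).
Proof. by move=> /family_normsqE <-; rewrite /family_energy /energy /vol mulrAC. Qed.

Lemma criticalP h : Sp1 h -> critical_in_family r1 r2 r3 h <-> eigvec lam h.
Proof.
move=> h1; split=> [crit k l|/(eigvecP _ h1) eig c c1 c0 dc].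
  have [->|kl] := eqVneq k l; first by rewrite subrr mul0r.
  (* The energy has derivative [- 2 vol (lam_k - lam_l) h_k h_l] along this rotation. *)
  have := crit (rotation h k l) (fun t => rotation_Sp1 kl t h1) (rotation0 h k l)
    (@derivable_rotation _ h k l).
  rewrite (_ : (fun t => _) = fun t => vol * (normsq_offset +
      \sum_j lam j * (rotation h k l t 0 j - 0) ^+ 2)); last first.
    apply/funext => t; rewrite family_energyE; last exact: rotation_Sp1.
    by under [in RHS]eq_bigr do rewrite subr0.
  move=> dE; have := @derive_val _ _ _ _ _ _ _ dE.
  have dQ := is_derive_quadratic vol normsq_offset lam (fun=> 0)
    (is_derive_rotation h k l).
  rewrite (@derive_val _ _ _ _ _ _ _ dQ) => /eqP; rewrite mulf_eq0 (negPf vol_neq0) /=.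
  rewrite (bigD1 k) //= (bigD1 l) /=; last by rewrite eq_sym.
  rewrite big1 => [|j /andP[/negPf jk /negPf jl]]; last by rewrite jk jl !mulr0.
  rewrite rotation0 !eqxx (eq_sym l) (negPf kl) !subr0 addr0 => /eqP e0.
  apply: (@pnatr_inj _ 1); rewrite mulr0 -[RHS]oppr0 -e0; ring.
(* If [h] has eigenvalue [mu], then on the unit sphere
   [sum_k lam_k c_k^2 = mu + sum_k (lam_k - mu) (c_k - h_k)^2]. *)
set mu := \sum_l lam l * h 0 l ^+ 2 in eig.
rewrite (_ : (fun t => _) = fun t => vol * ((normsq_offset + mu) +
    \sum_k (lam k - mu) * (c t 0 k - h 0 k) ^+ 2)); last first.
  apply/funext => t; rewrite family_energyE // -addrA; congr (_ * (_ + _)).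
  have c1t : \sum_k c t 0 k ^+ 2 = 1 by exact: c1.
  rewrite -{1}[mu]mulr1 -c1t mulr_sumr -big_split /=; apply: eq_bigr => k _.
  rewrite [X in _ = _ + X](_ : _ = (lam k - mu) * c t 0 k ^+ 2
    + (lam k - mu) * h 0 k * (h 0 k - 2 * c t 0 k)); last by ring.
  by rewrite eig mul0r addr0; ring.
have dck k : is_derive (0 : R) (1 : R) (fun t => c t 0 k) ('D_1 (fun t => c t 0 k) 0).
  by apply: derivableP; have /derivable_mxP := dc; apply.
have := is_derive_quadratic vol (normsq_offset + mu) (fun k => lam k - mu) (h 0) dck.
by rewrite big1 ?mulr0 // => k _; rewrite c0 subrr mulr0 mul0r mulr0.
Qed.

End Family.

(** * The critical set *)

Section CriticalSet.
Variable R : realType.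
Implicit Types (h : quat R) (lam : 'I_4 -> R).

Lemma cls_image (A : set (quat R)) h :
  (forall x, A x -> A (- x)) -> (@cls R @` A) (cls h) -> A h.
Proof.
move=> AN [x Ax clsx]; have : cls x h by rewrite clsx; left.
by case=> ->; last apply: AN.
Qed.

Lemma Sp1N h : Sp1 h -> Sp1 (- h).
Proof. by rewrite /Sp1 /= => <-; apply: eq_bigr => k _; rewrite mxE sqrrN. Qed.

Lemma S1E k l h : S1 k l (cls h) -> h 0 k ^+ 2 + h 0 l ^+ 2 = 1.
Proof. by case/cls_image => [x [/Sp1N x1 xkl]|_ //]; split=> //; rewrite !mxE !sqrrN. Qed.

Lemma S2E k l m h :
  S2 k l m (cls h) -> h 0 k ^+ 2 + h 0 l ^+ 2 + h 0 m ^+ 2 = 1.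
Proof. by case/cls_image => [x [/Sp1N x1 xkl]|_ //]; split=> //; rewrite !mxE !sqrrN. Qed.

Lemma NSE k h : NS k (cls h) -> h 0 k ^+ 2 = 1.
Proof.
case/cls_image => [x [/Sp1N x1 xk]|_ [] ->]; rewrite ?sqrrN ?expr1n //.
by split=> //; rewrite !mxE; case: xk => ->; rewrite ?opprK; [right|left].
Qed.

Lemma pairwise_ord4 lam (x : 'I_4 -> R) :
  let m k l := (lam k - lam l) * (x k * x l) in
  m 0 1 = 0 -> m 0 2%:R = 0 -> m 0 3%:R = 0 -> m 1 2%:R = 0 -> m 1 3%:R = 0 ->
  m 2%:R 3%:R = 0 -> forall k l, m k l = 0.
Proof.
move=> m; have mC k l : m k l = 0 -> m l k = 0.
  by move=> e; rewrite -[RHS]oppr0 -e /m; ring.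
have mm k : m k k = 0 by rewrite /m subrr mul0r.
move=> *; apply: (@ord4_ind (fun k => forall l, m k l = 0)) => l; move: l.
all: by apply: (@ord4_ind (fun l => m _ l = 0)) => //; apply: mC.
Qed.

(** A general bijection [s] treats the three cyclic copies of the list at once. *)
Lemma listed_eigvec r1 r2 r3 (s : 'I_4 -> 'I_4) lam h : Sp1 h -> bijective s ->
  rho0 r1 r2 r3 = lam (s 0) - lam (s 2%:R) ->
  rho1 r1 r2 r3 = lam (s 1) - lam (s 2%:R) ->
  rho3 r1 r2 r3 = lam (s 3%:R) - lam (s 2%:R) ->
  listed r1 r2 r3 s (cls h) -> eigvec lam h.
Proof.
move=> h1 s_bij p0 p1 p3 h_in; have [s' _ s'K] := s_bij.
suff eig k l : (lam (s k) - lam (s l)) * (h 0 (s k) * h 0 (s l)) = 0.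
  by move=> k l; rewrite -(s'K k) -(s'K l).
have x1 : h 0 (s 0) ^+ 2 + h 0 (s 1) ^+ 2 + h 0 (s 2%:R) ^+ 2 + h 0 (s 3%:R) ^+ 2 = 1.
  transitivity (\sum_k h 0 (s k) ^+ 2); first by rewrite sum_ord4.
  have <- : \sum_k h 0 k ^+ 2 = 1 by exact: h1.
  by rewrite [RHS](reindex s) //; apply: onW_bij.
have {}p0 : lam (s 0) = rho0 r1 r2 r3 + lam (s 2%:R) by rewrite p0 subrK.
have {}p1 : lam (s 1) = rho1 r1 r2 r3 + lam (s 2%:R) by rewrite p1 subrK.
have {}p3 : lam (s 3%:R) = rho3 r1 r2 r3 + lam (s 2%:R) by rewrite p3 subrK.
have sq2 (a b : R) : a ^+ 2 + b ^+ 2 = 0 -> a = 0 /\ b = 0.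
  move/eqP; rewrite paddr_eq0 ?sqr_ge0 // !sqrf_eq0 => /andP[/eqP -> /eqP ->].
  by [].
have rhofxxx (x : R) : x ^+ 3 = 1 -> rhof x x x = 0.
  move=> x3; apply/eqP; rewrite mulf_eq0; apply/orP; right; apply/eqP.
  transitivity (x ^+ 6 * (1 - (x ^+ 3) ^+ 3)); first by ring.
  by rewrite x3 expr1n subrr mulr0.
have pairs := @pairwise_ord4 (lam \o s) (fun k => h 0 (s k)).
move: k l; case: h_in => [[[[[[[[]|[]]|[]]|[]]|[]]|[]]|[]]|].
- move=> [e12 e23 r3_1] _; move: p0 p1 p3.
  rewrite /rho0 /rho1 /rho3 -e23 -e12 rhofxxx // => p0 p1 p3.
  by apply: pairs => /=; rewrite ?p0 ?p1 ?p3; ring.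
(* For equal parameters the three [rho] coincide, so [lam] agrees at [s 0], [s 1] and [s 3]. *)
- move=> [e12 e23 _]; move: p0 p1 p3.
  rewrite /rho0 /rho1 /rho3 -e23 -e12 => p0 p1 p3.
  case=> /cls_image h_in.
    have [|_ X2] := h_in.
      by move=> x [/Sp1N ? x2]; split=> //; rewrite mxE x2 oppr0.
    by apply: pairs => /=; rewrite ?p0 ?p1 ?p3 ?X2; ring.
  have [|X0 X1 X3 _] := h_in.
    move=> x [x0 x1' x3 x2]; split; rewrite !mxE ?x0 ?x1' ?x3 ?oppr0 //.
    by case: x2 => ->; rewrite ?opprK; [right|left].
  by apply: pairs => /=; rewrite ?X0 ?X1 ?X3; ring.
- move=> e0 /S1E x02.
  have [X1 X3] : h 0 (s 1) = 0 /\ h 0 (s 3%:R) = 0 by apply: sq2; lra.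
  by apply: pairs => /=; rewrite ?p0 ?e0 ?X1 ?X3; ring.
- move=> [e13 _] /S1E x13.
  have [X0 X2] : h 0 (s 0) = 0 /\ h 0 (s 2%:R) = 0 by apply: sq2; lra.
  by apply: pairs => /=; rewrite ?p1 ?p3 ?e13 ?X0 ?X2; ring.
- move=> [e1 e3] /S2E x123.
  have X0 : h 0 (s 0) = 0 by apply/eqP; rewrite -sqrf_eq0; apply/eqP; lra.
  by apply: pairs => /=; rewrite ?p1 ?p3 ?e1 ?e3 ?X0; ring.
- move=> [e01 e13 _] /S2E x013.
  have X2 : h 0 (s 2%:R) = 0 by apply/eqP; rewrite -sqrf_eq0; apply/eqP; lra.
  by apply: pairs => /=; rewrite ?p0 ?p1 ?p3 ?e01 ?e13 ?X2; ring.
- move=> [e0 e1 e3] _.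
  by apply: pairs => /=; rewrite ?p0 ?p1 ?p3 ?e0 ?e1 ?e3; ring.
case=> k _ /NSE hk.
have X j : j != k -> h 0 (s j) = 0.
  move=> jk; apply/eqP; rewrite -sqrf_eq0; apply/eqP.
  have : \sum_j h 0 (s j) ^+ 2 = 1 by rewrite sum_ord4.
  rewrite (bigD1 k) //= hk -[RHS]addr0 => /addrI/eqP.
  rewrite psumr_eq0 => [/allP/(_ j)|? _]; last exact: sqr_ge0.
  by rewrite mem_index_enum jk => /(_ isT)/eqP.
move=> j l; have [->|jl] := eqVneq j l; first by rewrite subrr mul0r.
have [jk|/X ->] := eqVneq j k; last by rewrite mul0r mulr0.
by rewrite (X l) ?mulr0 // -jk eq_sym.
Qed.

(** * Membership in the listed sets *)

Section Listed.
Variables (r1 r2 r3 : R) (s : 'I_4 -> 'I_4) (h : quat R).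
Hypothesis h1 : Sp1 h.

Lemma listed_S1_02 : rho0 r1 r2 r3 = 0 ->
  h 0 (s 0) ^+ 2 + h 0 (s 2%:R) ^+ 2 = 1 -> listed r1 r2 r3 s (cls h).
Proof. by move=> p0 h02; do 5 left; right; split=> //; exists h. Qed.

Lemma listed_S2_123 : rho1 r1 r2 r3 = 0 -> rho3 r1 r2 r3 = 0 ->
  h 0 (s 1) ^+ 2 + h 0 (s 2%:R) ^+ 2 + h 0 (s 3%:R) ^+ 2 = 1 ->
  listed r1 r2 r3 s (cls h).
Proof. by move=> p1 p3 h123; do 3 left; right; split=> //; exists h. Qed.

(** The list puts [S1 (s 1) (s 3)] under a nonzero common value; if it is zero, the circle lies in
    the sphere [S2 (s 1) (s 2) (s 3)]. *)
Lemma listed_S1_13 : rho1 r1 r2 r3 = rho3 r1 r2 r3 -> h 0 (s 2%:R) = 0 ->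
  h 0 (s 1) ^+ 2 + h 0 (s 3%:R) ^+ 2 = 1 -> listed r1 r2 r3 s (cls h).
Proof.
move=> p13 h2 h13; have [p3|p3] := eqVneq (rho3 r1 r2 r3) 0.
  by apply: listed_S2_123; rewrite ?p13 // h2 expr0n addr0.
by do 4 left; right; split; [split=> //; apply/eqP|exists h].
Qed.

Lemma listed_RP3 : rho0 r1 r2 r3 = 0 -> rho1 r1 r2 r3 = 0 -> rho3 r1 r2 r3 = 0 ->
  listed r1 r2 r3 s (cls h).
Proof. by move=> p0 p1 p3; left; right; split=> //; exists h. Qed.

(** If the common value is zero, all of [RP3] is listed. *)
Lemma listed_S2_013 : rho0 r1 r2 r3 = rho1 r1 r2 r3 ->
  rho1 r1 r2 r3 = rho3 r1 r2 r3 ->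
  h 0 (s 0) ^+ 2 + h 0 (s 1) ^+ 2 + h 0 (s 3%:R) ^+ 2 = 1 ->
  listed r1 r2 r3 s (cls h).
Proof.
move=> p01 p13 h013; have [p3|p3] := eqVneq (rho3 r1 r2 r3) 0.
  by apply: listed_RP3; rewrite ?p01 ?p13.
by left; left; right; split; [split=> //; apply/eqP|exists h].
Qed.

End Listed.

Lemma eigvec_critical_set r1 r2 r3 lam h : Sp1 h ->
  rho0 r1 r2 r3 = lam 0 - lam 2%:R -> rho1 r1 r2 r3 = lam 1 - lam 2%:R ->
  rho3 r1 r2 r3 = lam 3%:R - lam 2%:R ->
  eigvec lam h -> critical_set r1 r2 r3 (cls h).
Proof.
move=> h1 p0 p1 p3 eig.
have eq_lam k l : h 0 k != 0 -> h 0 l != 0 -> lam k = lam l.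
  move=> hk hl; apply/eqP; rewrite -subr_eq0.
  by move/eqP: (eig k l); rewrite mulf_eq0 (negPf (mulf_neq0 hk hl)) orbF.
have poles (k : 'I_4) : h 0 k ^+ 2 = 1 -> critical_set r1 r2 r3 (cls h).
  move=> hk; left; left; right; exists k => //; exists h => //; split=> //.
  by move/eqP: hk; rewrite sqrf_eq1 => /orP[]/eqP ->; [left|right].
have r0 : h 0 0 != 0 -> h 0 2%:R != 0 -> rho0 r1 r2 r3 = 0.
  by move=> *; rewrite p0 (eq_lam 0 2%:R) ?subrr.
have r1E : h 0 1 != 0 -> h 0 2%:R != 0 -> rho1 r1 r2 r3 = 0.
  by move=> *; rewrite p1 (eq_lam 1 2%:R) ?subrr.
have r3E : h 0 3%:R != 0 -> h 0 2%:R != 0 -> rho3 r1 r2 r3 = 0.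
  by move=> *; rewrite p3 (eq_lam 3%:R 2%:R) ?subrr.
have r01 : h 0 0 != 0 -> h 0 1 != 0 -> rho0 r1 r2 r3 = rho1 r1 r2 r3.
  by move=> *; rewrite p0 p1 (eq_lam 0 1).
have r13 : h 0 1 != 0 -> h 0 3%:R != 0 -> rho1 r1 r2 r3 = rho3 r1 r2 r3.
  by move=> *; rewrite p1 p3 (eq_lam 1 3%:R).
have r30 : h 0 3%:R != 0 -> h 0 0 != 0 -> rho3 r1 r2 r3 = rho0 r1 r2 r3.
  by move=> *; rewrite p3 p0 (eq_lam 3%:R 0).
have := Sp1P h1.
(* Sixteen cases by the vanishing coordinates: those that are nonzero share their [lam], which gives
   the condition of a listed set. [left; left], [left; right] and [right] choose the copy for the
   identity, [relabel] and its square. *)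
have [X0|X0] := eqVneq (h 0 0) 0; have [X1|X1] := eqVneq (h 0 1) 0;
have [X2|X2] := eqVneq (h 0 2%:R) 0; have [X3|X3] := eqVneq (h 0 3%:R) 0;
rewrite ?X0 ?X1 ?X2 ?X3 ?expr0n /= ?addr0 ?add0r => x1.
- by move/eqP: x1; rewrite eq_sym oner_eq0.
- exact: poles x1.
- exact: poles x1.
- by right; apply: (listed_S1_02 h1 (r3E X3 X2)); rewrite addrC.
- exact: poles x1.
- by left; left; apply: (listed_S1_13 h1 (r13 X1 X3)).
- by left; right; apply: (listed_S1_02 h1 (r1E X1 X2)).
- by left; left; apply: (listed_S2_123 h1 (r1E X1 X2) (r3E X3 X2)).
- exact: poles x1.
- by left; right; apply: (listed_S1_13 h1 (r30 X3 X0)) => //; rewrite addrC.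
- by left; left; apply: (listed_S1_02 h1 (r0 X0 X2)).
- by left; right; apply: (listed_S2_123 h1 (r3E X3 X2) (r0 X0 X2)); rewrite -x1 /=; ring.
- by right; apply: (listed_S1_13 h1 (r01 X0 X1)).
- by left; left; apply: (listed_S2_013 h1 (r01 X0 X1) (r13 X1 X3)).
- by right; apply: (listed_S2_123 h1 (r0 X0 X2) (r1E X1 X2)); rewrite -x1 /=; ring.
- by left; left; apply: (listed_RP3 _ h1 (r0 X0 X2) (r1E X1 X2) (r3E X3 X2)).
Qed.

Lemma critical_setP r1 r2 r3 lam h : Sp1 h ->
  rho0 r1 r2 r3 = lam 0 - lam 2%:R -> rho1 r1 r2 r3 = lam 1 - lam 2%:R ->
  rho3 r1 r2 r3 = lam 3%:R - lam 2%:R ->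
  critical_set r1 r2 r3 (cls h) <-> eigvec lam h.
Proof.
move=> h1 p0 p1 p3; split=> [|eig]; last exact: eigvec_critical_set eig.
have relabelK : cancel relabel (relabel \o relabel).
  by apply: ord4_ind; apply: val_inj.
have relabelK' : cancel (relabel \o relabel) relabel.
  by apply: ord4_ind; apply: val_inj.
case=> [[]|]; apply: listed_eigvec => //.
- by exists id.
- by exists (relabel \o relabel).
- by exists relabel.
Qed.

End CriticalSet.

Theorem proposition4p1 (R : realType) (r1 r2 r3 : R)
    (r1_gt0 : 0 < r1) (r2_gt0 : 0 < r2) (r3_gt0 : 0 < r3) :
  [/\ (forall h : quat R, Sp1 h ->
         critical_in_family r1 r2 r3 h <-> critical_set r1 r2 r3 (cls h)),
      (forall h : quat R, Sp1 h ->
         harmonic_G2 (metric r1 r2 r3) (phi r1 r2 r3 h)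
         <-> critical_set r1 r2 r3 (cls h))
    & rho0 r1 r2 r3 = 0 -> rho1 r1 r2 r3 = 0 -> rho3 r1 r2 r3 = 0 ->
      forall h h' : quat R, Sp1 h -> Sp1 h' ->
        family_torsion_normsq r1 r2 r3 h = family_torsion_normsq r1 r2 r3 h'].
Proof.
have [/esym p0 /esym p1 /esym p3] := eigval_rho r1_gt0 r2_gt0 r3_gt0.
have critE h (h1 : Sp1 h) :=
  critical_setP (lam := fun k => eigval r1 r2 r3 k) h1 p0 p1 p3.
split=> [h h1|h h1|].
- by rewrite criticalP // critE.
- by rewrite harmonicP // critE.
rewrite p0 p1 p3 => e0 e1 e3.
(* If all [rho] vanish, the [lam_k] are all equal and the quadratic form is constant on the
   sphere. *)
suff const h : Sp1 h -> family_torsion_normsq r1 r2 r3 h =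
    normsq_offset r1 r2 r3 + eigval r1 r2 r3 2.
  by move=> h h' h1 h'1; rewrite !const.
move=> h1; rewrite family_normsqE //; congr (_ + _).
rewrite -[RHS]mulr1 -(Sp1P h1) sum_ord4 /=.
move/eqP: e0; rewrite subr_eq0 => /eqP ->; move/eqP: e1; rewrite subr_eq0 => /eqP ->.
by move/eqP: e3; rewrite subr_eq0 => /eqP ->; ring.
Qed.
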